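(* For all $2\pi$-periodic functions $u$ with zero mean, $\int_{-\pi}^{\pi}u(x)\,dx=0$, the following interpolation inequalities hold: $$\|u\|_{L_\infty(\mathbb T^1)}^2\le\|u\|_{L_2(\mathbb T^1)}\|u'\|_{L_2(\mathbb T^1)}-\frac1\pi\|u\|_{L_2(\mathbb T^1)}^2,\qquad u\in H^1(\mathbb T^1),$$ $$\|u\|_{L_\infty(\mathbb T^1)}^2\le\frac{\sqrt2}{\sqrt[4]{27}}\|u\|_{L_2(\mathbb T^1)}^{3/2}\|u''\|_{L_2(\mathbb T^1)}^{1/2}-\frac2{3\pi}\|u\|_{L_2(\mathbb T^1)}^2,\qquad u\in H^2(\mathbb T^1),$$ and all constants in these inequalities are sharp.
   Context: $\mathbb T^1=[-\pi,\pi]$ with periodic boundary conditions and Lebesgue measure; $H^m(\mathbb T^1)$ is the Sobolev space of $2\pi$-periodic functions. ''All constants are sharp'' means: the coefficient of the leading (product) term cannot be decreased, whatever the coefficient of $\|u\|^2$; and, with the leading coefficient as given, the coefficient $\frac1\pi$ (respectively $\frac2{3\pi}$) of the subtracted term cannot be increased. *)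

(* Defs.v *)
From mathcomp Require Import all_boot all_order all_algebra.
From mathcomp Require Import all_classical all_reals all_analysis.
Set Implicit Arguments.
Unset Strict Implicit.
Unset Printing Implicit Defensive.
Import Order.TTheory GRing.Theory Num.Theory.
Import numFieldNormedType.Exports.

Local Open Scope classical_set_scope.
Local Open Scope ring_scope.

(* Functions on the circle are 2 pi-periodic functions on the line; norms and
   integrals are taken over the period [-pi, pi]. *)
Definition torus_measure (R : realType) : {measure set (measurableTypeR R) -> \bar R} :=
  mrestr (@lebesgue_measure R) (measurable_itv `[- pi, pi]).

Definition L2_torus (R : realType) (u : R -> R) : Prop :=
  periodic u (pi *+ 2) /\ u \in Lfun (torus_measure R) 2%:E.

Definition zero_mean (R : realType) (u : R -> R) : Prop :=
  \int[@lebesgue_measure R]_(x in `[- pi, pi]) u x = 0.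

Definition test_function (R : realType) (phi : R -> R) : Prop :=
  periodic phi (pi *+ 2) /\
  forall (n : nat) (x : R), derivable (phi^`(n))%classic x 1.

(* The sign and the absence of boundary terms come from integrating by parts
   k times against a smooth periodic function. *)
Definition weak_derivative (R : realType) (k : nat) (u v : R -> R) : Prop :=
  forall phi : R -> R, test_function phi ->
    \int[@lebesgue_measure R]_(x in `[- pi, pi]) (u x * (phi^`(k))%classic x) =
    (-1) ^+ k * \int[@lebesgue_measure R]_(x in `[- pi, pi]) (v x * phi x).

Definition sobolev_torus (R : realType) (m : nat) (u : R -> R) : Prop :=
  L2_torus u /\
  forall k : nat, (k <= m)%N ->
    exists v : R -> R, L2_torus v /\ weak_derivative k u v.

Local Open Scope ereal_scope.

Definition L2norm (R : realType) (u : R -> R) : \bar R :=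
  'N[torus_measure R]_2%:E[EFin \o u].

(* The essential supremum of |u|, a priori possibly +oo. *)
Definition Linfnorm (R : realType) (u : R -> R) : \bar R :=
  'N[torus_measure R]_(+oo)[EFin \o u].

(* C is the coefficient of the product term, c the coefficient of the
   subtracted term; both may have any sign. The derivative is determined by u
   only almost everywhere, hence the quantification over its representatives
   du, d2u. *)
Definition interpolation_H1 (R : realType) (C c : R) : Prop :=
  forall u du : R -> R,
    sobolev_torus 1 u -> zero_mean u ->
    L2_torus du -> weak_derivative 1 u du ->
    Linfnorm u ^+ 2 <=
      C%:E * (L2norm u * L2norm du) - c%:E * L2norm u ^+ 2.

Definition interpolation_H2 (R : realType) (C c : R) : Prop :=
  forall u d2u : R -> R,
    sobolev_torus 2 u -> zero_mean u ->
    L2_torus d2u -> weak_derivative 2 u d2u ->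
    Linfnorm u ^+ 2 <=
      C%:E * (L2norm u `^ (3 / 2)%R * L2norm d2u `^ (1 / 2)%R)
      - c%:E * L2norm u ^+ 2.

(* The coefficient C0 of the product term cannot be decreased, whatever the
   coefficient of the L2 term, and for this C0 the coefficient c0 of the
   subtracted term cannot be increased. *)
Definition sharp_constants (R : realType) (ineq : R -> R -> Prop)
    (C0 c0 : R) : Prop :=
  (forall C c : R, ineq C c -> (C0 <= C)%R) /\
  (forall c : R, ineq C0 c -> (c <= c0)%R).

(* Main.v *)
Require Import Defs.
From mathcomp Require Import all_boot all_order all_algebra.
From mathcomp Require Import all_classical all_reals all_analysis.
From mathcomp Require Import measurable_realfun ess_sup_inf ring lra.
Import Order.TTheory GRing.Theory Num.Theory.
Import numFieldNormedType.Exports.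

(** Let [a = |u|^2], [b = |u^(m)|^2] (squared L2 norms, m = 1 or 2) and let
    [A_k], [B_k] be the cosine and sine coefficients of u.  The proof rests on
    one estimate: for every [lam >= 0],

      [|u|_oo^2 <= (1/pi) * T(lam) * (b + lam * a)],
      [T(lam) = sum_(k >= 1) 1 / (k^(2m) + lam)],

    which is Cauchy-Schwarz for the Fourier series of u with the weights
    [k^(2m) + lam], followed by Bessel's inequality for u and for its weak
    derivative ([multiplier_sup_bound]).  The weak derivative is tested only on
    [cos (k x)] and [sin (k x)], which gives the coefficients of [u^(m)]
    ([weak1_fpower], [weak2_fpower]).  That u is almost everywhere the sum of its
    (absolutely convergent) Fourier series follows because a square
    integrable function with vanishing coefficients vanishes almost everywhere
    ([zero_fcoef_ae0]).  The same fact gives [a <= b] ([multiplier_sq_le]), so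
    that only [D = sqrt (b / a) >= 1] has to be considered.

    The sums [T(lam)] have closed forms; the upper bound that is needed comes
    from Bessel's inequality for a function h on the period that solves
    [h' = s h], respectively [h'' = 2 nu h' - 2 nu^2 h], because then
    [A_k(h)^2 + B_k(h)^2] is exactly a constant over [k^2 + s^2], respectively
    [k^4 + 4 nu^4] ([sum_inv_sq_le], [sum_inv_quartic_le]).  Up to exponentially
    small errors,

      [T(s^2) = pi / (2 s) - 1 / (2 s^2)],
      [T(4 nu^4) = pi / (8 nu^3) - 1 / (8 nu^4)],

    where the second terms are the missing mode k = 0: they produce the
    subtracted multiples of [|u|^2].  It remains to choose [lam].  The value
    that is optimal for the first terms alone is not good enough, since it
    leaves the exponentially small errors uncompensated; lowering s by [1/pi],
    or nu by [1/(3 pi)], gains a term of the order of a negative power of D,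
    which dominates them for all [D >= 1] ([exists_shift_H1], [exists_shift_H2]).

    For sharpness one inserts the extremal functions of the corresponding
    inequalities on the line, [exp (- n |x|)] and
    [exp (- n |x|) (cos (n x) + sin (n |x|))], minus their means.  For integer
    n the latter is of class H^2 on the circle, because its derivative vanishes
    at pi.  The subtracted mean is [1 / (n pi)] up to an exponentially small
    error, the squared norm is of order [1/n], and comparing the terms of order
    1 and of order [1/n] in the inequality gives the two constants
    ([sharpness_criterion]). *)

Set Implicit Arguments.
Unset Strict Implicit.
Unset Printing Implicit Defensive.
Local Open Scope classical_set_scope.
Local Open Scope ring_scope.

(** * Integration over a period *)

Section PeriodIntegral.
Context {R : realType}.
Local Notation mu := (@lebesgue_measure R).
Implicit Types f g u v : R -> R.

Definition pint f : R := \int[mu]_(x in `[- pi, pi]) f x.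

Definition pintegrable f := mu.-integrable `[- pi, pi] (EFin \o f).

Definition sqintegrable f :=
  measurable_fun (`[- pi, pi] : set (measurableTypeR R)) f /\ pintegrable (fun x
    => f x ^+ 2).

Lemma ae_imply (P Q : R -> Prop) : (forall x, P x -> Q x) ->
  {ae mu, forall x, P x} -> {ae mu, forall x, Q x}.
Proof. by move=> PQ; apply: filterS => //;
  exact: (ae_filter_ringOfSetsType mu). Qed.

Lemma ae_imply2 (P Q S : R -> Prop) : (forall x, P x -> Q x -> S x) ->
  {ae mu, forall x, P x} -> {ae mu, forall x, Q x} -> {ae mu, forall x, S x}.
Proof. by move=> PQS; apply: filterS2 => //;
  exact: (ae_filter_ringOfSetsType mu). Qed.

Lemma ae_neq (a : R) : {ae mu, forall x, x <> a}.
Proof.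
exists [set a]; split; first exact: measurable_set1.
  exact: lebesgue_measure_set1.
by move=> x /=; apply: contra_notP => xa ax; apply: xa; exact: ax.
Qed.

Lemma ltNpi_pi : - pi < pi :> R.
Proof. by have := pi_gt0 R; lra. Qed.

Lemma period_measure : mu `[- pi, pi] = (pi *+ 2)%:E.
Proof. by rewrite lebesgue_measure_itv/= lte_fin ltNpi_pi -EFinB opprK -mulr2n.
  Qed.

Lemma mperiod : measurable (`[- pi, pi] : set (measurableTypeR R)).
Proof. exact: measurable_itv. Qed.
Hint Resolve mperiod : core.

Lemma eq_pint f g : (forall x, - pi <= x <= pi -> f x = g x) -> pint f = pint g.
Proof.
by move=> fg; apply: eq_Rintegral => x; rewrite inE/= in_itv/= => /fg.
Qed.

Lemma eq_pintegrable f g : (forall x, - pi <= x <= pi -> f x = g x) ->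
  pintegrable f -> pintegrable g.
Proof.
move=> fg; apply: eq_integrable => // x; rewrite inE/= in_itv/= => xD.
by rewrite /= fg.
Qed.

Lemma pintegrableD f g : pintegrable f -> pintegrable g ->
  pintegrable (fun x => f x + g x).
Proof. by move=> fi gi; exact: (integrableD mperiod fi gi). Qed.

Lemma pintegrableZ a f : pintegrable f -> pintegrable (fun x => a * f x).
Proof. by move=> fi; have := integrableZl mperiod a fi. Qed.

Lemma pintegrableN f : pintegrable f -> pintegrable (fun x => - f x).
Proof. by move=> fi; exact: (integrableN fi). Qed.

Lemma pintegrable_sum I (r : seq I) (P : pred I) (F : I -> R -> R) :
  (forall i, pintegrable (F i)) ->
  pintegrable (fun x => \sum_(i <- r | P i) F i x).
Proof.
move=> Fi; elim: r => [|i r ih].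
  apply: (@eq_pintegrable (fun=> 0)); first by move=> x _; rewrite big_nil.
  exact: integrable0.
case Pi : (P i).
  apply: (@eq_pintegrable (fun x => F i x + \sum_(j <- r | P j) F j x)).
    by move=> x _; rewrite big_cons Pi.
  exact: pintegrableD.
by apply: eq_pintegrable ih => x _; rewrite big_cons Pi.
Qed.

Lemma pintD f g : pintegrable f -> pintegrable g ->
  pint (fun x => f x + g x) = pint f + pint g.
Proof. by move=> fi gi; rewrite /pint RintegralD. Qed.

Lemma pintB f g : pintegrable f -> pintegrable g ->
  pint (fun x => f x - g x) = pint f - pint g.
Proof. by move=> fi gi; rewrite /pint RintegralB. Qed.

Lemma pintZ a f : pintegrable f -> pint (fun x => a * f x) = a * pint f.
Proof. by move=> fi; rewrite /pint RintegralZl. Qed.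

Lemma pint_sum I (r : seq I) (P : pred I) (F : I -> R -> R) :
  (forall i, pintegrable (F i)) ->
  pint (fun x => \sum_(i <- r | P i) F i x) = \sum_(i <- r | P i) pint (F i).
Proof.
move=> Fi; elim: r => [|i r ih].
  rewrite big_nil; transitivity (pint (fun=> 0)).
    by apply: eq_pint => x _; rewrite big_nil.
  by rewrite /pint /Rintegral integral0.
rewrite big_cons; case Pi : (P i); last first.
  by rewrite -ih; apply: eq_pint => x _; rewrite big_cons Pi.
rewrite -ih -pintD//; last exact: pintegrable_sum.
by apply: eq_pint => x _; rewrite big_cons Pi.
Qed.

Lemma pint_ge0 f : (forall x, 0 <= f x) -> 0 <= pint f.
Proof. by move=> f0; apply: Rintegral_ge0 => x _. Qed.

Lemma pintegrable_continuous f : continuous f -> pintegrable f.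
Proof.
move=> cf; apply: continuous_compact_integrable; first exact: segment_compact.
exact: continuous_subspaceT.
Qed.

Lemma sqintegrable_continuous f : continuous f -> sqintegrable f.
Proof.
move=> cf; split.
  by apply: measurable_funTS; exact: continuous_measurable_fun.
apply: pintegrable_continuous => x.
exact: (continuous_comp (cf x) (@exprn_continuous _ 2 _)).
Qed.

Lemma pintegrable_le f g : measurable_fun (`[- pi,
  pi] : set (measurableTypeR R)) f ->
  (forall x, `|f x| <= g x) -> pintegrable g -> pintegrable f.
Proof.
move=> mf fg; apply: le_integrable => //; first exact/measurable_EFinP.
by move=> x _ /=; rewrite lee_fin (le_trans (fg x))// ler_norm.
Qed.

Lemma sqintegrable_mul f g : sqintegrable f -> sqintegrable g ->
  pintegrable (fun x => f x * g x).
Proof.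
move=> [mf f2] [mg g2].
apply: (@pintegrable_le _ (fun x => f x ^+ 2 + g x ^+ 2)).
- exact: measurable_funM.
- by move=> x; rewrite ler_norml; apply/andP; split; nra.
- exact: pintegrableD.
Qed.

Lemma sqintegrable_pintegrable f : sqintegrable f -> pintegrable f.
Proof.
move=> fi; apply: (@eq_pintegrable (fun x => f x * cst 1 x)).
  by move=> x _; rewrite /= mulr1.
by apply: sqintegrable_mul => //; apply: sqintegrable_continuous => x;
  exact: cvg_cst.
Qed.

Lemma sqintegrableZ a f : sqintegrable f -> sqintegrable (fun x => a * f x).
Proof.
move=> [mf f2]; split; first exact: measurable_funM.
apply: (@eq_pintegrable (fun x => a ^+ 2 * f x ^+ 2)) => [x _|].
  by rewrite exprMn.
exact: pintegrableZ.
Qed.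

Lemma sqintegrableD f g : sqintegrable f -> sqintegrable g ->
  sqintegrable (fun x => f x + g x).
Proof.
move=> fi gi; have [[mf f2] [mg g2]] := (fi, gi); split.
  exact: measurable_funD.
apply: (@eq_pintegrable (fun x => f x ^+ 2 + (2 * (f x * g x) + g x ^+ 2))).
  by move=> x _; ring.
by do 2 (apply: pintegrableD => //); apply/pintegrableZ/sqintegrable_mul.
Qed.

Lemma sqintegrable_bounded f M : measurable_fun (`[- pi,
  pi] : set (measurableTypeR R)) f ->
  (forall x, `|f x| <= M) -> sqintegrable f.
Proof.
move=> mf fM; split => //; apply: (@pintegrable_le _ (fun=> M ^+ 2)).
- exact: measurable_funX.
- by move=> x; rewrite normrX ler_sqr ?nnegrE// (le_trans _ (fM x)).
- by apply: pintegrable_continuous => x; exact: cvg_cst.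
Qed.

Lemma pint_FTC f (F : R -> R) : continuous f ->
  (forall x : R, is_derive x 1 F (f x)) -> pint f = F pi - F (- pi).
Proof.
move=> cf dF; rewrite /pint /Rintegral (@continuous_FTC2 _ f F)//.
- exact: ltNpi_pi.
- exact: continuous_subspaceT.
- have cF : continuous F.
    by move=> x; apply: differentiable_continuous; apply/derivable1_diffP;
      case: (dF x).
  split; first by move=> x _; case: (dF x).
  + by apply: cvg_at_right_filter; exact: cF.
  + by apply: cvg_at_left_filter; exact: cF.
- by move=> x _; rewrite derive1E; have [_] := dF x.
Qed.

End PeriodIntegral.

(** * Trigonometric orthogonality and Bessel's inequality *)

Section Bessel.
Context {R : realType}.
Implicit Types f g : R -> R.

(** The square of [f - sum_i t_i e_i], with [t_i] the coefficient of f divided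
    by [n i], has nonnegative integral.  A vanishing [n i] is harmless because
    then [t_i = 0]; this allows the function [sin (0 x)] in the family. *)
Lemma bessel_orthogonal_family (I : finType) (e : I -> R -> R) (n : I -> R) f :
  (forall i, sqintegrable (e i)) -> sqintegrable f ->
  (forall i j, pint (fun x => e i x * e j x) = (i == j)%:R * n i) ->
  \sum_i pint (fun x => f x * e i x) ^+ 2 / n i <= pint (fun x => f x ^+ 2).
Proof.
move=> ei fi orth; pose c i := pint (fun x => f x * e i x).
pose t i := c i / n i.
have fei i : pintegrable (fun x => f x * e i x) by exact: sqintegrable_mul.
have eei i j : pintegrable (fun x => e i x * e j x) by exact: sqintegrable_mul.
have tfei i : pintegrable (fun x => t i * (f x * e i x)) by exact: pintegrableZ.
have teei i j : pintegrable (fun x => t i * t j * (e i x * e j x)).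
  exact: pintegrableZ.
have ti i : t i ^+ 2 * n i = t i * c i.
  rewrite /t; have [->|n0] := eqVneq (n i) 0;
    first by rewrite invr0 !mulr0 mul0r.
  by field.
have sq x : (f x - \sum_i t i * e i x) ^+ 2 =
    f x ^+ 2 - (2 * \sum_i t i * (f x * e i x)
                - \sum_i \sum_j t i * t j * (e i x * e j x)).
  rewrite sqrrB opprB -addrA [- _ + _]addrC; congr (_ + (_ - _)).
    rewrite expr2 mulr_suml; apply: eq_bigr => i _; rewrite mulr_sumr.
    by apply: eq_bigr => j _; ring.
  rewrite -mulr_natl !mulr_sumr; apply: eq_bigr => i _; ring.
have := pint_ge0 (fun x => sqr_ge0 (f x - \sum_i t i * e i x)).
rewrite (eq_pint (fun x _ => sq x)) pintB; last 2 first.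
- exact: fi.2.
- apply: pintegrableD; first by apply/pintegrableZ/pintegrable_sum.
  by apply/pintegrableN/pintegrable_sum => i; exact: pintegrable_sum.
rewrite pintB; last 2 first.
- by apply/pintegrableZ/pintegrable_sum.
- by apply/pintegrable_sum => i; exact: pintegrable_sum.
rewrite pintZ; last exact: pintegrable_sum.
rewrite !pint_sum//; last by move=> i; exact: pintegrable_sum.
rewrite subr_ge0; apply: le_trans; rewrite le_eqVlt; apply/orP; left; apply/eqP.
have -> : \sum_i pint (fun x => \sum_j t i * t j * (e i x * e j x)) =
    \sum_i t i * c i.
  apply: eq_bigr => i _; rewrite pint_sum// (bigD1 i)//= big1 => [|j ji].
    by rewrite pintZ// orth eqxx mul1r addr0 -ti expr2.
  by rewrite pintZ// orth eq_sym (negbTE ji) mul0r mulr0.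
have -> : \sum_i pint (fun x => t i * (f x * e i x)) = \sum_i t i * c i.
  by apply: eq_bigr => i _; rewrite pintZ.
rewrite mulr_natl mulr2n addrK; apply: eq_bigr => i _.
by rewrite -/(c i) /t; ring.
Qed.

End Bessel.

Section Trigonometric.
Context {R : realType}.
Implicit Types (f g : R -> R) (m : R) (k : nat).

Lemma is_derive_mull m (x : R) : is_derive x 1 (fun y => m * y) m.
Proof. by have := is_deriveZ m (is_derive_id x (1 : R));
  rewrite /GRing.scale/= mulr1. Qed.

Lemma is_derive_sinZ m (x : R) :
  is_derive x 1 (fun y => sin (m * y)) (m * cos (m * x)).
Proof.
have := @is_derive1_comp R (@sin R) (fun y =>
  m * y) x _ _ (is_derive_sin _) (is_derive_mull m x).
by rewrite mulrC.
Qed.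

Lemma is_derive_cosZ m (x : R) :
  is_derive x 1 (fun y => cos (m * y)) (- (m * sin (m * x))).
Proof.
have := @is_derive1_comp R (@cos R) (fun y =>
  m * y) x _ _ (is_derive_cos _) (is_derive_mull m x).
by rewrite mulrC mulrN.
Qed.

Lemma is_derive_expZ m (x : R) :
  is_derive x 1 (fun y => expR (m * y)) (m * expR (m * x)).
Proof.
have := @is_derive1_comp R (@expR R) (fun y =>
  m * y) x _ _ (is_derive_expR _) (is_derive_mull m x).
by rewrite mulrC.
Qed.

Lemma is_derive_cont f (df : R -> R) :
  (forall x : R, is_derive x 1 f (df x)) -> continuous f.
Proof.
move=> fd x; apply: differentiable_continuous; apply/derivable1_diffP.
by case: (fd x).
Qed.

Lemma continuous_cosZ m : continuous (fun x : R => cos (m * x)).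
Proof. exact: is_derive_cont (is_derive_cosZ m). Qed.

Lemma continuous_sinZ m : continuous (fun x : R => sin (m * x)).
Proof. exact: is_derive_cont (is_derive_sinZ m). Qed.

Lemma continuous_expZ m : continuous (fun x : R => expR (m * x)).
Proof. exact: is_derive_cont (is_derive_expZ m). Qed.

Lemma sin_natpi k : sin (k%:R * pi) = 0 :> R.
Proof.
elim: k => [|k ih]; first by rewrite mul0r sin0.
by rewrite -natr1 mulrDl mul1r sinDpi ih oppr0.
Qed.

Lemma cos_natpi k : cos (k%:R * pi) = (-1) ^+ k :> R.
Proof.
elim: k => [|k ih]; first by rewrite mul0r cos0.
by rewrite -natr1 mulrDl mul1r cosDpi ih exprS mulN1r.
Qed.

Lemma pint_cst (a : R) : pint (fun=> a) = a * (2 * pi).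
Proof.
rewrite /pint Rintegral_cst; last exact: mperiod.
rewrite [X in fine X](_ : _ = (pi *+ 2)%:E); last exact: period_measure.
by rewrite /= mulr_natl.
Qed.

Lemma pint_cosZ m : m != 0 -> sin (m * pi) = 0 ->
  pint (fun x => cos (m * x)) = 0.
Proof.
move=> m0 smpi.
have dF (x : R) : is_derive x 1 (fun x => m^-1 * sin (m * x)) (cos (m * x)).
  have := is_deriveZ m^-1 (is_derive_sinZ m x).
  by rewrite /GRing.scale/= mulrA mulVf// mul1r.
by rewrite (pint_FTC (@continuous_cosZ m) dF) mulrN sinN smpi oppr0 subrr.
Qed.

Lemma pint_sinZ m : pint (fun x => sin (m * x)) = 0.
Proof.
have [->|m0] := eqVneq m 0.
  transitivity (pint (fun=> 0 : R)); last by rewrite pint_cst mul0r.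
  by apply: eq_pint => x _; rewrite mul0r sin0.
have dF (x : R) : is_derive x 1 (fun x => - m^-1 * cos (m * x)) (sin (m * x)).
  have := is_deriveZ (- m^-1) (is_derive_cosZ m x).
  by rewrite /GRing.scale/= mulrNN mulrA mulVf// mul1r.
by rewrite (pint_FTC (@continuous_sinZ m) dF) mulrN cosN subrr.
Qed.

(** [b = true] is the cosine; the pair [(b, k)] indexes the orthogonal
    family. *)
Definition trig (b : bool) k (x : R) : R :=
  if b then cos (k%:R * x) else sin (k%:R * x).

Definition trig_norm (b : bool) k : R :=
  if k == 0%N then (if b then 2 * pi else 0) else pi.

Lemma continuous_trig b k : continuous (trig b k).
Proof. by case: b; [exact: continuous_cosZ|exact: continuous_sinZ]. Qed.

Lemma sqintegrable_trig b k : sqintegrable (trig b k).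
Proof. exact/sqintegrable_continuous/continuous_trig. Qed.

Lemma pint_cos_nat_diff (j k : nat) :
  pint (fun x => cos ((j%:R - k%:R) * x)) = if j == k then 2 * pi else 0 :> R.
Proof.
case: eqP => [->|/eqP jk].
  transitivity (pint (fun=> 1 : R)); last by rewrite pint_cst mul1r.
  by apply: eq_pint => x _; rewrite subrr mul0r cos0.
rewrite pint_cosZ// ?subr_eq0 ?eqr_nat// mulrBl sinB !sin_natpi.
by rewrite mulr0 mul0r subrr.
Qed.

Lemma pint_cos_nat_sum (j k : nat) :
  pint (fun x => cos ((j%:R + k%:R) * x)) =
  if (j == 0%N) && (k == 0%N) then 2 * pi else 0 :> R.
Proof.
have := pint_cos_nat_diff (j + k) 0.
rewrite addn_eq0 => <-; apply: eq_pint => x _.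
by rewrite subr0 natrD.
Qed.

Lemma trig_orthogonal (p q : bool * nat) :
  pint (fun x => trig p.1 p.2 x * trig q.1 q.2 x) =
  (p == q)%:R * trig_norm p.1 p.2.
Proof.
case: p q => [b j] [c k] /=; rewrite /trig_norm xpair_eqE.
have i1 (m : R) : pintegrable (fun x : R => 2^-1 * cos (m * x)).
  exact/pintegrableZ/pintegrable_continuous/continuous_cosZ.
have i2 (m : R) : pintegrable (fun x : R => 2^-1 * sin (m * x)).
  exact/pintegrableZ/pintegrable_continuous/continuous_sinZ.
have i3 (m : R) : pintegrable (fun x : R => cos (m * x)).
  exact/pintegrable_continuous/continuous_cosZ.
have i4 (m : R) : pintegrable (fun x : R => sin (m * x)).
  exact/pintegrable_continuous/continuous_sinZ.
case: b c => -[]; rewrite /= ?eqxx/=.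
- transitivity (pint (fun x : R => 2^-1 * cos ((j%:R - k%:R) * x) +
      2^-1 * cos ((j%:R + k%:R) * x))).
    by apply: eq_pint => x _; rewrite /trig mulrBl mulrDl cosB cosD; field.
  rewrite pintD// !pintZ// pint_cos_nat_diff pint_cos_nat_sum.
  case: (eqVneq j k) => [->|jk]; last first.
    rewrite mulr0 mul0r add0r; case: ifPn; last by rewrite mulr0.
    by move=> /andP[/eqP j0 /eqP k0]; rewrite j0 k0 in jk.
  by case: (k == 0%N) => /=; field.
- transitivity (pint (fun x : R => 2^-1 * sin ((j%:R + k%:R) * x) -
      2^-1 * sin ((j%:R - k%:R) * x))).
    by apply: eq_pint => x _; rewrite /trig mulrBl mulrDl sinB sinD; field.
  by rewrite pintB// !pintZ// !pint_sinZ mul0r mulr0 subrr.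
- transitivity (pint (fun x : R => 2^-1 * sin ((j%:R + k%:R) * x) +
      2^-1 * sin ((j%:R - k%:R) * x))).
    by apply: eq_pint => x _; rewrite /trig mulrBl mulrDl sinB sinD; field.
  by rewrite pintD// !pintZ// !pint_sinZ mul0r mulr0 addr0.
- transitivity (pint (fun x : R => 2^-1 * cos ((j%:R - k%:R) * x) -
      2^-1 * cos ((j%:R + k%:R) * x))).
    by apply: eq_pint => x _; rewrite /trig mulrBl mulrDl cosB cosD; field.
  rewrite pintB// !pintZ// pint_cos_nat_diff pint_cos_nat_sum.
  case: (eqVneq j k) => [->|jk]; last first.
    rewrite mulr0 mul0r add0r; case: ifPn; last by rewrite mulr0 oppr0.
    by move=> /andP[/eqP j0 /eqP k0]; rewrite j0 k0 in jk.
  by case: (k == 0%N) => /=; field.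
Qed.

Definition fcoef f b k : R := pint (fun x => f x * trig b k x).

Definition fpower f k : R := fcoef f true k ^+ 2 + fcoef f false k ^+ 2.

Lemma fpower_ge0 f k : 0 <= fpower f k.
Proof. by rewrite addr_ge0 ?sqr_ge0. Qed.

Lemma bessel f N : sqintegrable f ->
  fcoef f true 0 ^+ 2 / (2 * pi) + \sum_(k < N) fpower f k.+1 / pi <=
  pint (fun x => f x ^+ 2).
Proof.
move=> fi.
have := @bessel_orthogonal_family R (bool * 'I_N.+1)%type (fun p =>
  trig p.1 p.2)
  (fun p => trig_norm p.1 p.2) f (fun p => sqintegrable_trig _ _) fi
  (fun p q => trig_orthogonal (p.1, val p.2) (q.1, val q.2)).
apply: le_trans; rewrite le_eqVlt; apply/orP; left; apply/eqP.
rewrite -(pair_big xpredT xpredT (fun b (k : 'I_N.+1) =>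
  pint (fun x => f x * trig b k x) ^+ 2 / trig_norm b k))/=.
rewrite big_bool/= !big_ord_recl /trig_norm/= invr0 mulr0 add0r -addrA.
congr (_ + _); rewrite -big_split/=; apply: eq_bigr => i _.
by rewrite /fpower mulrDl.
Qed.

End Trigonometric.

(** * A function is determined by its Fourier coefficients *)

Section DominatedConvergence.
Context {R : realType}.
Local Notation mu := (@lebesgue_measure R).
Local Notation D := (`[- pi, pi]%classic : set (measurableTypeR R)).

Lemma pint_dominated (fn : nat -> R -> R) (f g : R -> R) :
  (forall n, measurable_fun D (fn n)) -> measurable_fun D f -> pintegrable g ->
  {ae mu, forall x, - pi <= x <= pi -> fn ^~ x @ \oo --> f x} ->
  (forall n x, - pi <= x <= pi -> `|fn n x| <= g x) ->
  pint (fn n) @[n --> \oo] --> pint f.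
Proof.
move=> mfn mf ig fnf fng.
have := @dominated_convergence _ _ _ mu D (@mperiod R) (fun n x => (fn n x)%:E)
  (EFin \o f) (EFin \o g).
case.
- by move=> n; exact/measurable_EFinP.
- exact/measurable_EFinP.
- apply: ae_imply fnf => x fx; rewrite /= in_itv/= => xD.
  by apply: cvg_EFin; [exact: nearW|exact: fx].
- exact: ig.
- apply: aeW => x n; rewrite /= in_itv/= => xD.
  by rewrite lee_fin fng.
move=> fi _ cv; rewrite /pint /Rintegral.
apply: fine_cvg; rewrite fineK//.
exact: integrable_fin_num.
Qed.

End DominatedConvergence.

Section StepApproximation.
Context {R : realType}.
Implicit Types (s t : R) (n m : nat).

(** The polynomials of Stone's proof of the Weierstrass theorem: on [0, 1] they
    tend to the indicator of [s < 1/2] away from 1/2, with values in [0, 1]. *)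
Definition sharpen n s : R := (1 - s ^+ n) ^+ (2 ^ n).

Lemma bernoulli_ineq t m : 0 <= t <= 1 -> 1 - m%:R * t <= (1 - t) ^+ m.
Proof.
move=> /andP[t0 t1]; elim: m => [|m ih]; first by rewrite mul0r subr0 expr0.
rewrite exprS; apply: (@le_trans _ _ ((1 - t) * (1 - m%:R * t))); last first.
  by rewrite ler_wpM2l// subr_ge0.
have m0 : 0 <= (m%:R : R) by exact: ler0n.
rewrite -natr1; nra.
Qed.

Lemma bernoulli_decay t m : 0 <= t <= 1 -> (1 - t) ^+ m * (1 + m%:R * t) <= 1.
Proof.
move=> /andP[t0 t1]; elim: m => [|m ih];
  first by rewrite expr0 mul0r addr0 mul1r.
apply: le_trans ih; rewrite exprSr -mulrA ler_wpM2l ?exprn_ge0 ?subr_ge0//.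
have m0 : 0 <= (m%:R : R) by exact: ler0n.
rewrite -natr1; nra.
Qed.

Lemma sharpen_bound n s : 0 <= s <= 1 -> 0 <= sharpen n s <= 1.
Proof.
move=> /andP[s0 s1].
have sn : 0 <= 1 - s ^+ n <= 1.
  by rewrite subr_ge0 exprn_ile1//= gerBl exprn_ge0.
by have /andP[? ?] := sn; rewrite exprn_ge0//= exprn_ile1.
Qed.

Lemma sharpen_cvg1 s : 0 <= s < 2^-1 -> sharpen n s @[n --> \oo] --> (1 : R).
Proof.
move=> /andP[s0 s2].
have s01 n : 0 <= s ^+ n <= 1 by rewrite exprn_ge0//= exprn_ile1//; lra.
apply: (@squeeze_cvgr _ _ _ _ (fun n => 1 - (2 * s) ^+ n) (fun=> 1)).
- apply: nearW => n; apply/andP; split; last first.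
    by have /andP[] : 0 <= sharpen n s <= 1 by apply: sharpen_bound;
      rewrite s0/=; lra.
  by have := bernoulli_ineq (2 ^ n) (s01 n); rewrite natrX -exprMn.
- rewrite -[X in _ --> X]subr0; apply: cvgB; first exact: cvg_cst.
  by apply: cvg_expr; rewrite ger0_norm; lra.
- exact: cvg_cst.
Qed.

Lemma sharpen_cvg0 s : 2^-1 < s <= 1 -> sharpen n s @[n --> \oo] --> (0 : R).
Proof.
move=> /andP[s2 s1]; have s0 : 0 <= s by lra.
have s01 n : 0 <= s ^+ n <= 1 by rewrite exprn_ge0//= exprn_ile1.
apply: (@squeeze_cvgr _ _ _ _ (fun=> 0) (fun n => (2 * s)^-1 ^+ n)).
- apply: nearW => n; have /andP[q0 _] : 0 <= sharpen n s <=
  1 by apply: sharpen_bound; rewrite s0.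
  rewrite q0/= exprVn -div1r ler_pdivlMr ?exprn_gt0//; last lra.
  apply: le_trans (bernoulli_decay (2 ^ n) (s01 n)).
  rewrite -/(sharpen n s) ler_wpM2l// natrX -exprMn; lra.
- exact: cvg_cst.
- apply: cvg_expr; rewrite ger0_norm ?invr_ge0; last lra.
  by rewrite invf_lt1; lra.
Qed.

End StepApproximation.

Section Uniqueness.
Context {R : realType}.
Local Notation mu := (@lebesgue_measure R).
Local Notation D := (`[- pi, pi]%classic : set (measurableTypeR R)).
Implicit Types phi psi : R -> R.
Variable f : R -> R.
Hypothesis fi : sqintegrable f.
Hypothesis f0 : forall b k, fcoef f b k = 0.

(** The product formulas, in the only form that matters: multiplication by
    [cos x] or [sin x] preserves the span of the trigonometric functions. *)
Lemma trig_mul e b k : exists (a1 a2 : R) b' j1 j2, forall x : R,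
  trig e 1 x * trig b k x = a1 * trig b' j1 x + a2 * trig b' j2 x.
Proof.
rewrite /trig; case: k => [|k].
  exists (b%:R), 0, e, 1%N, 0%N => x.
  by rewrite !mul0r addr0; case: b;
    rewrite ?cos0 ?sin0 /= ?mulr1 ?mul1r ?mulr0 ?mul0r.
have E (x : R) : (k.+2%:R * x = k.+1%:R * x + 1%:R * x) * (k%:R * x =
  k.+1%:R * x - 1%:R * x).
  by split; rewrite -?[k.+2%:R]natr1 -?[k.+1%:R]natr1; ring.
case: e b => -[].
- exists 2^-1, 2^-1, true, k.+2, k => x.
  by rewrite !E cosB cosD; field.
- exists 2^-1, 2^-1, false, k.+2, k => x.
  by rewrite !E sinB sinD; field.
- exists 2^-1, (- 2^-1), false, k.+2, k => x.
  by rewrite !E sinB sinD; field.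
- exists 2^-1, (- 2^-1), true, k, k.+2 => x.
  by rewrite !E cosB cosD; field.
Qed.

(** These phi form a linear space that is stable under multiplication by
    [cos x] and [sin x], hence contains every polynomial in [cos (x - c)]. *)
Definition annihilates (phi : R -> R) := continuous phi /\
  forall b k, pint (fun x => f x * (phi x * trig b k x)) = 0.

Lemma fphi_int phi : continuous phi -> pintegrable (fun x => f x * phi x).
Proof. by move=> c; apply: sqintegrable_mul => //;
  exact: sqintegrable_continuous. Qed.

Lemma fphit_int phi b k : continuous phi ->
  pintegrable (fun x => f x * (phi x * trig b k x)).
Proof.
move=> c; apply: (@fphi_int (fun x => phi x * trig b k x)) => x.
by apply: cvgM; [exact: c|exact: continuous_trig].
Qed.

Lemma annihilates1 : annihilates (fun=> 1).
Proof.
split; first by move=> x; exact: cvg_cst.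
by move=> b k; rewrite -[RHS](f0 b k); apply: eq_pint => x _; rewrite mul1r.
Qed.

Lemma annihilatesD phi psi : annihilates phi -> annihilates psi ->
  annihilates (fun x => phi x + psi x).
Proof.
move=> [cp ap] [cq aq]; split; first by move=> x; apply: cvgD;
  [exact: cp|exact: cq].
move=> b k.
rewrite -[RHS]addr0 -{1}(ap b k) -{1}(aq b k) -pintD; [|exact: fphit_int..].
by apply: eq_pint => x _; ring.
Qed.

Lemma annihilatesZ a phi : annihilates phi -> annihilates (fun x => a * phi x).
Proof.
move=> [cp ap]; split; first by move=> x; apply: cvgMr; exact: cp.
move=> b k; rewrite -[RHS](mulr0 a) -(ap b k) -pintZ; last exact: fphit_int.
by apply: eq_pint => x _; ring.
Qed.

Lemma annihilates_trig e phi : annihilates phi ->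
  annihilates (fun x => trig e 1 x * phi x).
Proof.
move=> [cp ap]; split.
  by move=> x; apply: cvgM; [exact: continuous_trig|exact: cp].
move=> b k; have [a1 [a2 [b' [j1 [j2 E]]]]] := trig_mul e b k.
transitivity (pint (fun x => a1 * (f x * (phi x * trig b' j1 x)) +
                             a2 * (f x * (phi x * trig b' j2 x)))).
  apply: eq_pint => x _.
  by rewrite [trig e 1 x * _]mulrC -[phi x * _ * _]mulrA E; ring.
rewrite pintD; [|exact/pintegrableZ/fphit_int..].
by rewrite !pintZ ?ap ?mulr0 ?addr0//; exact: fphit_int.
Qed.

(** An affine function of [cos (x - c)] with values in [0, 1] that is below
    1/2 exactly on the arc of radius d around c; composing it with [sharpen n]
    gives trigonometric polynomials tending to the indicator of the arc. *)
Definition bump c d (x : R) : R := 2^-1 - (cos (x - c) - cos d) / 4.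

Lemma eq_annihilates phi psi : phi =1 psi -> annihilates phi -> annihilates psi.
Proof. by move=> /funext ->. Qed.

Lemma annihilates_bump c d phi : annihilates phi ->
  annihilates (fun x => bump c d x * phi x).
Proof.
move=> ap.
apply: (@eq_annihilates (fun x => ((2^-1 + cos d / 4) * phi x) +
    ((- (cos c / 4)) * (trig true 1 x * phi x) +
      (- (sin c / 4)) * (trig false 1 x * phi x)))).
  by move=> x; rewrite /bump /trig cosB !mul1r; field.
apply: annihilatesD; first exact: annihilatesZ.
by apply: annihilatesD; apply/annihilatesZ/annihilates_trig.
Qed.

Lemma annihilates_sharpen c d n : annihilates (fun x => sharpen n (bump c d x)).
Proof.
have X m phi : annihilates phi ->
  annihilates (fun x => bump c d x ^+ m * phi x).
  move=> ap; elim: m => [|m ih].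
    by apply: eq_annihilates ap => x; rewrite mul1r.
  by apply: eq_annihilates (annihilates_bump c d ih) => x; rewrite exprS mulrA.
rewrite /sharpen; elim: (2 ^ n)%N => [|m ih]; first exact: annihilates1.
apply: (@eq_annihilates (fun x => (1 - bump c d x ^+ n) ^+ m +
   (-1) * (bump c d x ^+ n * (1 - bump c d x ^+ n) ^+ m))).
  by move=> x; rewrite exprS; ring.
by apply: annihilatesD => //; apply/annihilatesZ/X.
Qed.

Lemma pint_sharpen0 c d n : pint (fun x => f x * sharpen n (bump c d x)) = 0.
Proof.
have [_ /(_ true 0%N) <-] := annihilates_sharpen c d n.
by apply: eq_pint => x _; rewrite /trig mul0r cos0 mulr1.
Qed.

Lemma bump_bound c d x : 0 <= bump c d x <= 1.
Proof.
rewrite /bump; have := cos_le1 (x - c); have := cos_geN1 (x - c).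
have := cos_le1 d; have := cos_geN1 d.
move=> *; apply/andP; split; lra.
Qed.

Lemma bump_lt c d x : 0 < d -> d < pi -> `|x - c| < d -> bump c d x < 2^-1.
Proof.
move=> d0 dpi xd; rewrite /bump.
suff : cos d < cos (x - c) by lra.
by rewrite -[in ltRHS]cos_norm ltr_cos// in_itv/=; apply/andP; split;
  rewrite ?normr_ge0//; lra.
Qed.

Lemma bump_gt c d x : 0 < d -> - pi < c - d -> c + d < pi -> - pi <= x <= pi ->
  d < `|x - c| -> 2^-1 < bump c d x.
Proof.
move=> d0 cd1 cd2 /andP[x1 x2] dx; rewrite /bump.
suff : cos (x - c) < cos d by lra.
rewrite -[in ltLHS]cos_norm; have [xpi|xpi] := leP `|x - c| pi.
  by rewrite ltr_cos// in_itv/=; apply/andP; split; rewrite ?normr_ge0//; lra.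
have -> : cos `|x - c| = cos (pi *+ 2 - `|x - c|).
  by rewrite -cosN -[in LHS]cosD2pi addrC.
have xc : `|x - c| < pi + pi - d by rewrite ltr_norml; apply/andP; split; lra.
rewrite mulr2n ltr_cos ?in_itv/=; first lra.
- by apply/andP; split; lra.
- by apply/andP; split; lra.
Qed.

(** Limit of [pint_sharpen0]: the trigonometric polynomials
    [sharpen n (bump c d x)] converge boundedly to the indicator of the ball. *)
Lemma pint_interval0 c d : 0 < d -> - pi < c - d -> c + d < pi ->
  \int[mu]_(x in ball c d) f x = 0.
Proof.
move=> d0 cd1 cd2; have dpi : d < pi by lra.
have sub : (ball c d : set (measurableTypeR R)) `<=` D.
  move=> x; rewrite ball_itv/= !in_itv/= => /andP[? ?]; apply/andP; split; lra.
have mball : measurable (ball c d : set (measurableTypeR R)) by exact: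
  measurable_ball.
have cb n : continuous (fun x => sharpen n (bump c d x)).
  by case: (annihilates_sharpen c d n).
have cv : pint (fun x => f x * sharpen n (bump c d x)) @[n --> \oo] -->
    pint (fun x => f x * \1_(ball c d) x).
  apply: (@pint_dominated _ _ _ (fun x => `|f x|)).
  - move=> n; apply: measurable_funM; first exact: fi.1.
    by apply: measurable_funTS; exact: continuous_measurable_fun.
  - by apply: measurable_funM; [exact: fi.1|exact: measurable_indic].
  - exact/integrable_norm/sqintegrable_pintegrable.
  - apply: ae_imply2 (ae_neq (c - d)) (ae_neq (c + d)) => x xcd1 xcd2 xD.
    apply: cvgM; first exact: cvg_cst.
    rewrite indicE; have [xd|dx] := ltP `|x - c| d.
      rewrite mem_set; last by rewrite /ball/= distrC.
      apply: sharpen_cvg1; have /andP[-> _] := bump_bound c d x.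
      exact: bump_lt.
    rewrite memNset/=; last by rewrite /ball/= distrC; apply/negP;
      rewrite -leNgt.
    apply: sharpen_cvg0; have /andP[_ ->] := bump_bound c d x.
    rewrite andbT bump_gt// lt_neqAle dx andbT.
    apply/negP => /eqP dxc; have [xc|xc] := leP 0 (x - c).
      by apply: xcd2; rewrite dxc ger0_norm//; ring.
    by apply: xcd1; rewrite dxc ltr0_norm//; ring.
  - move=> n x _; rewrite normrM ler_piMr//.
    have /andP[q0 q1] := sharpen_bound n (bump_bound c d x).
    by rewrite ger0_norm.
have <- : pint (fun x => f x * \1_(ball c d) x) = 0.
  rewrite -(cvg_lim (@Rhausdorff R) cv).
  under eq_fun do rewrite pint_sharpen0.
  exact: lim_cst.
rewrite -[X in Rintegral _ X](setIidr sub) Rintegral_mkcondr;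
  apply: eq_pint => x _.
by rewrite patchE indicE; case: (_ \in _); rewrite ?mulr1 ?mulr0.
Qed.

(** The primitive of f is constant by [pint_interval0], and almost everywhere
    its derivative is f. *)
Lemma zero_fcoef_ae0 : {ae mu, forall x, - pi < x < pi -> f x = 0}.
Proof.
pose g := f \_ (`[- pi, pi] : set R).
have gi : mu.-integrable setT (EFin \o g).
  have /= := (@integrable_mkcond _ _ _ mu D (EFin \o f)
    (@mperiod R)).1 (sqintegrable_pintegrable fi).
  by rewrite restrict_EFin.
have giS (A : set (measurableTypeR R)) : measurable A ->
  mu.-integrable A (EFin \o g).
  by move=> mA; apply: integrableS gi.
have lg : locally_integrable setT g.
  by apply: open_integrable_locally => //; exact: openT.
have F0 x y : - pi < x -> x < y -> y < pi ->
    \int[mu]_(t in `[- pi, y]) g t = \int[mu]_(t in `[- pi, x]) g t.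
  move=> x1 xy y1; apply/eqP; rewrite -subr_eq0; apply/eqP.
  rewrite Rintegral_itvB; [|exact: giS|by rewrite bnd_simp ltW|by rewrite
    bnd_simp ltW].
  rewrite -Rintegral_itv_bndo_bndc; last exact: giS.
  have := @pint_interval0 ((x + y) / 2) ((y - x) / 2).
  rewrite ball_itv (_ : (x + y) / 2 - _ = x); last by field.
  rewrite (_ : (x + y) / 2 + _ = y); last by field.
  move=> <- //; last by lra.
  apply: eq_Rintegral => t; rewrite inE/= in_itv/= => /andP[xt ty].
  by rewrite /g patchE mem_set//= in_itv/=; apply/andP; split; lra.
have := @FTC1 R g (BLeft (- pi)) (fun y => giS _ (measurable_itv _)) lg.
apply: ae_imply => x + /andP[x1 x2].
have ax : ((- pi)%:E < x%:E)%E by rewrite lte_fin.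
move=> /(_ ax) [_ Fx].
suff : g x = 0.
  by rewrite /g patchE mem_set//= in_itv/=; apply/andP; split; lra.
rewrite -Fx derive1E.
pose F0x := \int[mu]_(t in `[- pi, x]) g t.
have [_ <-] := is_derive_cst F0x x (1 : R).
apply: near_eq_derive; near=> y.
have y1 : - pi < y by near: y; exact: lt_nbhsr.
have y2 : y < pi by near: y; exact: lt_nbhsl.
have [yx|xy|->//] := ltgtP y x; first by rewrite /F0x (F0 y x).
exact: F0.
Unshelve. all: by end_near. Qed.

End Uniqueness.

(** * Absolutely convergent Fourier series *)

Section FourierSeries.
Context {R : realType}.
Local Notation mu := (@lebesgue_measure R).
Local Notation D := (`[- pi, pi]%classic : set (measurableTypeR R)).

Lemma eq_pint_ae (f g : R -> R) : measurable_fun D f -> measurable_fun D g ->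
  {ae mu, forall x, - pi < x < pi -> f x = g x} -> pint f = pint g.
Proof.
move=> mf mg fg; rewrite /pint /Rintegral; congr fine.
apply: ae_eq_integral; [exact: mperiod|exact/measurable_EFinP..|].
apply: ae_imply2 fg (@ae_imply2 _ _ _ (fun x =>
  x <> - pi /\ x <> pi) _ (ae_neq (- pi)) (ae_neq pi)).
  move=> x fgx [xpi1 xpi2]; rewrite /= in_itv/= => /andP[x1 x2]; congr EFin.
  apply: fgx; rewrite !lt_neqAle x1 x2 !andbT; apply/andP; split;
    apply/eqP => //.
  by move/esym.
by move=> x; split.
Qed.

Variable u : R -> R.
Hypothesis ui : sqintegrable u.
Hypothesis u0 : fcoef u true 0 = 0.
Variable M : R.
Hypothesis uM : forall N, \sum_(k < N) Num.sqrt (fpower u k.+1) <= pi * M.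

Let t k (x : R) := (fcoef u true k.+1 * trig true k.+1 x +
                fcoef u false k.+1 * trig false k.+1 x) / pi.

Let S N (x : R) := \sum_(k < N) t k x.

(** The wave of amplitudes a and b is a sinusoid of amplitude
    [sqrt (a^2 + b^2)]. *)
Lemma wave_le (a b x : R) : `|a * cos x + b * sin x| <=
  Num.sqrt (a ^+ 2 + b ^+ 2).
Proof.
rewrite -sqrtr_sqr ler_wsqrtr// -[leRHS]mulr1 -(cos2Dsin2 x) -subr_ge0.
rewrite (_ : _ - _ = (a * sin x - b * cos x) ^+ 2) ?sqr_ge0//; ring.
Qed.

Let t_le k x : `|t k x| <= Num.sqrt (fpower u k.+1) / pi.
Proof.
by rewrite normrM [`|pi^-1|]ger0_norm ?invr_ge0 ?pi_ge0// ler_wpM2r ?invr_ge0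
  ?pi_ge0// wave_le.
Qed.

Let S_le N x : `|S N x| <= M.
Proof.
apply: (le_trans (ler_norm_sum _ _ _)).
apply: (@le_trans _ _ (\sum_(k < N) Num.sqrt (fpower u k.+1) / pi)).
  by apply: ler_sum => k _; exact: t_le.
by rewrite -mulr_suml ler_pdivrMr ?pi_gt0// mulrC.
Qed.

Let S_cvg x : cvgn (fun N => S N x).
Proof.
rewrite (_ : (fun N => S N x) = series (fun k => t k x)); last first.
  by apply/funext => N; rewrite /series/= big_mkord.
apply: normed_cvg; apply: (@series_le_cvg _ _ (fun k =>
  Num.sqrt (fpower u k.+1) / pi)).
- by move=> n; exact: normr_ge0.
- by move=> n; rewrite divr_ge0 ?pi_ge0 ?sqrtr_ge0.
- by move=> n; exact: t_le.
apply: nondecreasing_is_cvgn.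
  by apply: nondecreasing_series => n _ _; rewrite divr_ge0 ?pi_ge0 ?sqrtr_ge0.
exists M => _ [N _ <-]; rewrite /series/= big_mkord -mulr_suml.
by rewrite ler_pdivrMr ?pi_gt0// mulrC.
Qed.

Let w x := lim (S N x @[N --> \oo]).

Let S_meas N : measurable_fun D (S N).
Proof.
apply: measurable_sum => k; apply: measurable_funTS.
apply: continuous_measurable_fun => x; apply: cvgMl; apply: cvgD; apply: cvgMr;
  exact: continuous_trig.
Qed.

Let w_meas : measurable_fun D w.
Proof. by apply: (measurable_fun_cvg S_meas) => x _; exact: S_cvg. Qed.

Let w_le x : `|w x| <= M.
Proof.
rewrite ler_norml; apply/andP; split.
  by apply: limr_ge => //; apply: nearW => N; have := S_le N x;
    rewrite ler_norml => /andP[].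
by apply: limr_le => //; apply: nearW => N; have := S_le N x;
  rewrite ler_norml => /andP[].
Qed.

Let w_sqint : sqintegrable w.
Proof. exact: sqintegrable_bounded w_meas w_le. Qed.

Let S_fcoef g N : sqintegrable g -> pint (fun x => g x * S N x) =
  \sum_(k < N) (fcoef u true k.+1 * fcoef g true k.+1 +
                fcoef u false k.+1 * fcoef g false k.+1) / pi.
Proof.
move=> gi; have gti b k : pintegrable (fun x => g x * trig b k x).
  by apply: sqintegrable_mul => //; exact: sqintegrable_trig.
transitivity (pint (fun x => \sum_(k < N)
    ((fcoef u true k.+1 / pi) * (g x * trig true k.+1 x) +
     (fcoef u false k.+1 / pi) * (g x * trig false k.+1 x)))).
  apply: eq_pint => x _; rewrite /S mulr_sumr; apply: eq_bigr => k _.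
  by rewrite /t; ring.
rewrite pint_sum => [|i]; last by apply: pintegrableD; exact: pintegrableZ.
apply: eq_bigr => k _; rewrite pintD; [|exact: pintegrableZ..].
by rewrite !pintZ// -!/(fcoef g _ _); ring.
Qed.

Lemma fcoef_trig b j c k : fcoef (trig b j) c k = ((b, j) == (c,
  k))%:R * trig_norm b j :> R.
Proof. exact: (trig_orthogonal (b, j) (c, k)). Qed.

Let pint_w_cvg g : sqintegrable g ->
  pint (fun x => g x * S N x) @[N --> \oo] --> pint (fun x => g x * w x).
Proof.
move=> gi; apply: (@pint_dominated _ _ _ (fun x => `|g x| * M)).
- by move=> N; apply: measurable_funM => //; exact: gi.1.
- by apply: measurable_funM => //; exact: gi.1.
- apply: (@eq_pintegrable _ (fun x => M * `|g x|)) => [x _|];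
  first by rewrite mulrC.
  exact/pintegrableZ/integrable_norm/sqintegrable_pintegrable.
- by apply: aeW => x _; apply: cvgMr; exact: S_cvg.
- by move=> N x _; rewrite normrM ler_wpM2l.
Qed.

Let w_fcoef b j : fcoef w b j = fcoef u b j.
Proof.
have cv := pint_w_cvg (sqintegrable_trig b j).
suff cv' : pint (fun x => trig b j x * S N x) @[N --> \oo] --> fcoef u b j.
  rewrite /fcoef; under eq_pint => x _ do rewrite mulrC.
  exact: (cvg_unique _ cv cv').
apply: cvg_near_cst; case: j {cv} => [|j].
  apply: nearW => N; rewrite S_fcoef; last exact: sqintegrable_trig.
  rewrite big1 => [|k _]; last first.
    by rewrite !fcoef_trig !xpair_eqE !andbF !mul0r !mulr0 add0r mul0r.
  case: b; first by rewrite u0.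
  rewrite /fcoef -[LHS](pint_sinZ 0).
  by apply: eq_pint => x _; rewrite /trig mul0r sin0 mulr0.
near=> N; rewrite S_fcoef; last exact: sqintegrable_trig.
have jN : (j < N)%N by near: N; exact: nbhs_infty_gt.
rewrite (bigD1 (Ordinal jN))//= big1 => [|k kj].
  rewrite !fcoef_trig !xpair_eqE !eqxx !andbT /trig_norm/= addr0.
  by case: b => /=; rewrite mul0r mul1r mulr0 ?addr0 ?add0r mulfK// gt_eqF//
    pi_gt0.
rewrite !fcoef_trig !xpair_eqE !eqSS [j == k]eq_sym.
have -> : (val k == j) = false by apply/negP => /eqP kj'; case/eqP: kj;
  apply: val_inj.
by rewrite !andbF !mul0r !mulr0 addr0 mul0r.
Unshelve. all: by end_near. Qed.

Let u_eq_w : {ae mu, forall x, - pi < x < pi -> u x = w x}.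
Proof.
(* u - w has vanishing coefficients. *)
have ngi : sqintegrable (fun x => -1 * w x) by exact: sqintegrableZ.
have di : sqintegrable (fun x => u x + -1 * w x) by exact: sqintegrableD.
suff d0 b k : fcoef (fun x => u x + -1 * w x) b k = 0.
  by apply: ae_imply (zero_fcoef_ae0 di d0) => x h /h; lra.
rewrite /fcoef.
have ti := @sqintegrable_trig R b k.
transitivity (pint (fun x => u x * trig b k x + -1 * (w x * trig b k x))).
  by apply: eq_pint => x _; ring.
rewrite pintD; [|exact: sqintegrable_mul|exact/pintegrableZ/sqintegrable_mul].
rewrite pintZ; last exact: sqintegrable_mul.
by rewrite -!/(fcoef _ _ _) w_fcoef; ring.
Qed.

(** The Fourier series converges absolutely, with partial sums bounded by M;
    its sum w has the same coefficients as u, hence equals u almost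
    everywhere. *)
Lemma fourier_sup_bound : {ae mu, forall x, - pi < x < pi -> `|u x| <= M}.
Proof. by apply: ae_imply u_eq_w => x /[apply] ->. Qed.

(** Integrate u times the partial sums: the left-hand sides of the hypothesis
    tend to the integral of [u * w = u^2]. *)
Lemma parseval_le b : (forall N, \sum_(k < N) fpower u k.+1 / pi <= b) ->
  pint (fun x => u x ^+ 2) <= b.
Proof.
move=> ub; have cv := pint_w_cvg ui.
have -> : pint (fun x => u x ^+ 2) = pint (fun x => u x * w x).
  apply: eq_pint_ae; [exact: measurable_funX ui.1|exact: measurable_funM ui.1
    w_meas|].
  by apply: ae_imply u_eq_w => x h /h <-; rewrite expr2.
apply: (cvgr_to_le cv); apply: nearW => N; by rewrite S_fcoef.
Qed.

End FourierSeries.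

(** * Weak derivatives as Fourier multipliers *)

Section WeakDerivativeCoefficients.
Context {R : realType}.
Implicit Types (u v : R -> R).

Lemma derive1_trig c b k :
  ((fun x : R => c * trig b k x)^`())%classic =
  (fun x => (if b then - (c * k%:R) else c * k%:R) * trig (~~ b) k x).
Proof.
apply/funext => x; rewrite derive1E; case: b.
  have [_ ->] := is_deriveZ c (is_derive_cosZ k%:R x).
  by rewrite /GRing.scale/= /trig mulrN mulNr mulrA.
have [_ ->] := is_deriveZ c (is_derive_sinZ k%:R x).
by rewrite /GRing.scale/= /trig mulrA.
Qed.

Lemma derivable_trig c b k (x : R) : derivable (fun x => c * trig b k x) x 1.
Proof.
case: b; first by have [] := is_deriveZ c (is_derive_cosZ k%:R x).
by have [] := is_deriveZ c (is_derive_sinZ k%:R x).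
Qed.

Lemma derive1n_trig b k n : exists (c : R) b',
  ((trig b k)^`(n))%classic = (fun x => c * trig b' k x).
Proof.
elim: n => [|n [c [b' ih]]].
  by exists 1, b; rewrite derive1n0; apply/funext => x; rewrite mul1r.
by rewrite derive1nS ih derive1_trig; eexists; exists (~~ b').
Qed.

Lemma periodic_trig b k : periodic (trig b k : R -> R) (pi *+ 2).
Proof.
move=> x; rewrite /trig mulrDr.
have -> : k%:R * (pi *+ 2) = (pi *+ 2) *+ k :> R by rewrite mulr_natl.
by case: b; rewrite periodicn//; [exact: cosD2pi|exact: sinD2pi].
Qed.

Lemma test_function_trig b k : test_function (trig b k : R -> R).
Proof.
split; first exact: periodic_trig.
by move=> n x; have [c [b' ->]] := derive1n_trig b k n; exact: derivable_trig.
Qed.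

Lemma derive1n1_trig b k : ((trig b k : R -> R)^`(1))%classic =
  (fun x => (if b then - k%:R else k%:R) * trig (~~ b) k x).
Proof.
rewrite derive1n1 (_ : trig b k = (fun x =>
  1 * trig b k x)) ?derive1_trig ?mul1r//.
by apply/funext => x; rewrite mul1r.
Qed.

Lemma derive1n2_trig b k : ((trig b k : R -> R)^`(2))%classic =
  (fun x => - (k%:R ^+ 2) * trig b k x).
Proof.
rewrite derive1nS derive1n1_trig derive1_trig negbK; apply/funext => x.
by case: b => /=; rewrite expr2 ?mulNr ?opprK.
Qed.

Lemma weak1_fcoef u v b k : sqintegrable u -> weak_derivative 1 u v ->
  (if b then - k%:R else k%:R) * fcoef u (~~ b) k = - fcoef v b k.
Proof.
move=> ui /(_ _ (test_function_trig b k));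
  rewrite derive1n1_trig expr1 mulN1r => /esym h.
rewrite [fcoef v b k in RHS]/fcoef [in RHS]/pint h /fcoef -pintZ;
  last by apply: sqintegrable_mul => //; exact: sqintegrable_trig.
by apply: eq_pint => x _; ring.
Qed.

Lemma weak2_fcoef u v b k : sqintegrable u -> weak_derivative 2 u v ->
  - (k%:R ^+ 2) * fcoef u b k = fcoef v b k.
Proof.
move=> ui /(_ _ (test_function_trig b k));
  rewrite derive1n2_trig sqrrN expr1n mul1r => /esym h.
rewrite [fcoef v b k in RHS]/fcoef [in RHS]/pint h /fcoef -pintZ;
  last by apply: sqintegrable_mul => //; exact: sqintegrable_trig.
by apply: eq_pint => x _; ring.
Qed.

Lemma weak1_fpower u v k : sqintegrable u -> weak_derivative 1 u v ->
  fpower v k = k%:R ^+ 2 * fpower u k.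
Proof.
move=> ui uv; have h1 : - k%:R * fcoef u false k =
  - fcoef v true k := weak1_fcoef true k ui uv.
have h2 : k%:R * fcoef u true k =
  - fcoef v false k := weak1_fcoef false k ui uv.
rewrite /fpower -[fcoef v true k]opprK -[fcoef v false k]opprK -h1 -h2.
by move: (k%:R : R) (fcoef u true k) (fcoef u false k) => K A B; ring.
Qed.

Lemma weak2_fpower u v k : sqintegrable u -> weak_derivative 2 u v ->
  fpower v k = k%:R ^+ 4 * fpower u k.
Proof.
move=> ui uv; have h := weak2_fcoef _ k ui uv.
by rewrite /fpower -!h; move: (k%:R : R) => K; ring.
Qed.

End WeakDerivativeCoefficients.

Section MultiplierBound.
Context {R : realType}.
Local Notation mu := (@lebesgue_measure R).

Lemma cauchy_schwarz_sum (I : finType) (a b : I -> R) :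
  (\sum_i a i * b i) ^+ 2 <= (\sum_i a i ^+ 2) * \sum_i b i ^+ 2.
Proof.
have E (c d : R) : \sum_i (c * a i - d * b i) ^+ 2 = c ^+ 2 * \sum_i a i ^+ 2
    - 2 * c * d * (\sum_i a i * b i) + d ^+ 2 * \sum_i b i ^+ 2.
  rewrite !mulr_sumr -sumrB -big_split/=; apply: eq_bigr => i _; ring.
move: E; set A := \sum_i a i ^+ 2; set B := \sum_i b i ^+ 2;
  set C := \sum_i a i * b i => E.
have B0 : 0 <= B by apply: sumr_ge0 => i _; exact: sqr_ge0.
have : 0 <= \sum_i (B * a i - C * b i) ^+ 2 by apply: sumr_ge0 => i _;
  exact: sqr_ge0.
rewrite E.
(* The sum of squares above is B * (A * B - C^2). *)
have [B00|Bn] := eqVneq B 0; last first.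
  have Bp : 0 < B by rewrite lt_neqAle eq_sym Bn.
  move=> h; have {h} : 0 <= B * (A * B - C ^+ 2) by apply: le_trans h _;
    rewrite le_eqVlt; apply/orP; left; apply/eqP; ring.
  by rewrite pmulr_rge0// subr_ge0.
move=> _; suff -> : C = 0 by rewrite B00 mulr0 expr0n.
rewrite /C big1// => i _; move: B00 => /eqP; rewrite psumr_eq0 => [|j _];
  last exact: sqr_ge0.
by move=> /allP /(_ i); rewrite mem_index_enum sqrf_eq0 => /(_ isT) /eqP ->;
  rewrite mulr0.
Qed.

Variables (u v : R -> R) (W : nat -> R) (lam T : R).
Hypothesis ui : sqintegrable u.
Hypothesis vi : sqintegrable v.
Hypothesis u0 : fcoef u true 0 = 0.
Hypothesis W1 : forall k, 1 <= W k.
Hypothesis lam0 : 0 <= lam.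
Hypothesis uv : forall k, fpower v k.+1 = W k * fpower u k.+1.
Hypothesis WT : forall N, \sum_(k < N) (W k + lam)^-1 <= T.

Let a := pint (fun x => u x ^+ 2).
Let b := pint (fun x => v x ^+ 2).

Let bessel0 (g : R -> R) N : sqintegrable g ->
  \sum_(k < N) fpower g k.+1 / pi <= pint (fun x => g x ^+ 2).
Proof.
move=> gi; apply: le_trans (bessel N gi); rewrite lerDr.
by rewrite divr_ge0 ?sqr_ge0// mulr_ge0// pi_ge0.
Qed.

Let M := Num.sqrt (T * (b + lam * a) / pi).

Let T0 : 0 <= T.
Proof. by apply: le_trans (WT 0); rewrite big_ord0. Qed.

Let Wl k : 0 < W k + lam.
Proof. by rewrite ltr_pwDl// (lt_le_trans ltr01). Qed.

Let coef_sum N : \sum_(k < N) Num.sqrt (fpower u k.+1) <= pi * M.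
Proof.
have a0 : 0 <= a by apply: pint_ge0 => x; exact: sqr_ge0.
have b0 : 0 <= b by apply: pint_ge0 => x; exact: sqr_ge0.
have pi0 := pi_gt0 R.
have M0 : 0 <= pi * M by rewrite mulr_ge0 ?sqrtr_ge0// ltW.
rewrite -ler_sqr ?nnegrE//; last by apply: sumr_ge0 => k _; exact: sqrtr_ge0.
have -> : (pi * M) ^+ 2 = T * (pi * (b + lam * a)).
  rewrite exprMn sqr_sqrtr; last first.
    by apply: divr_ge0; [apply: mulr_ge0 => //; apply: addr_ge0 => //;
      exact: mulr_ge0|exact: ltW].
  by move: (pi) (gt_eqF pi0) => p pn; field; rewrite pn.
pose p k := Num.sqrt (W k + lam)^-1;
  pose q k := Num.sqrt ((W k + lam) * fpower u k.+1).
have -> : \sum_(k < N) Num.sqrt (fpower u k.+1) = \sum_(k < N) p k * q k.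
  apply: eq_bigr => k _; rewrite /p /q -sqrtrM ?invr_ge0 ?ltW//.
  by rewrite mulrA mulVf ?mul1r// gt_eqF.
apply: (le_trans (cauchy_schwarz_sum _ _)); apply: ler_pM.
- by apply: sumr_ge0 => k _; exact: sqr_ge0.
- by apply: sumr_ge0 => k _; exact: sqr_ge0.
- apply: le_trans (WT N); apply: ler_sum => k _.
  by rewrite /p sqr_sqrtr// invr_ge0 ltW.
- apply: (@le_trans _ _ (\sum_(k < N) pi * (fpower v k.+1 / pi +
  lam * (fpower u k.+1 / pi)))).
    apply: ler_sum => k _; rewrite /q sqr_sqrtr;
      last by rewrite mulr_ge0 ?fpower_ge0// ltW.
    rewrite uv le_eqVlt; apply/orP; left; apply/eqP.
    by move: (pi) (gt_eqF pi0) => p' pn; field; rewrite pn.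
  rewrite -mulr_sumr; apply: ler_wpM2l; first exact: ltW.
  rewrite big_split/= -mulr_sumr; apply: lerD; first exact: bessel0.
  by apply: ler_wpM2l => //; exact: bessel0.
Qed.

(** Cauchy-Schwarz for [sum_k sqrt (fpower u k)] with weights [W k + lam], and
    Bessel's inequality for u and v. *)
Lemma multiplier_sup_bound : {ae mu, forall x, - pi < x < pi ->
  `|u x| <= Num.sqrt (T * (b + lam * a) / pi)}.
Proof. exact: fourier_sup_bound coef_sum. Qed.

(** Wirtinger's inequality: modes of a mean-zero function have [W k >= 1]. *)
Lemma multiplier_sq_le : a <= b.
Proof.
apply: (parseval_le ui u0 coef_sum) => N; apply: le_trans (bessel0 N vi).
apply: ler_sum => k _; rewrite ler_wpM2r ?invr_ge0 ?pi_ge0//.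
by rewrite uv ler_peMl ?fpower_ge0.
Qed.

End MultiplierBound.

(** * Upper bounds for the lattice sums *)

Section ExplicitSums.
Context {R : realType}.
Implicit Types (f g : R -> R) (s nu x : R).

Lemma is_derive_mul f g x (df dg : R) : is_derive x 1 f df ->
  is_derive x 1 g dg ->
  is_derive x 1 (fun y => f y * g y) (df * g x + f x * dg).
Proof.
move=> hf hg; have := is_deriveM hf hg.
by rewrite /GRing.scale/= addrC [g x * _]mulrC.
Qed.

Lemma is_derive_add f g x (df dg : R) : is_derive x 1 f df ->
  is_derive x 1 g dg ->
  is_derive x 1 (fun y => f y + g y) (df + dg).
Proof. by move=> hf hg; exact: is_deriveD. Qed.

Lemma is_derive_scal (a : R) f x (df : R) : is_derive x 1 f df ->
  is_derive x 1 (fun y => a * f y) (a * df).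
Proof. by move=> hf; have := is_deriveZ a hf. Qed.

(** [h = exp (s x)] solves [h' = s h], so integrating by parts against
    [exp (- i k x)] multiplies the coefficient by [s - i k] up to the jump
    of h across the period. *)
Lemma fpower_exp s k :
  fpower (fun x => expR (s * x)) k * (k%:R ^+ 2 + s ^+ 2) =
  (expR (s * pi) - expR (- (s * pi))) ^+ 2.
Proof.
pose h := fun x : R => expR (s * x); rewrite -/h.
rewrite -mulrN -/(h pi) -/(h (- pi)); set J := h pi - h (- pi).
have ch : continuous h by exact: continuous_expZ.
have hi : sqintegrable h by exact: sqintegrable_continuous.
have hti b : pintegrable (fun x => h x * trig b k x).
  by apply: sqintegrable_mul => //; exact: sqintegrable_trig.
have ct b c d : continuous (fun x =>
  c * (h x * trig b k x) + d * (h x * trig (~~ b) k x)).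
  move=> x; apply: cvgD; apply: cvgMr; apply: cvgM; [exact: ch| |exact: ch|];
    exact: continuous_trig.
have e1 : s * fcoef h true k + (- k%:R) * fcoef h false k = J * (-1) ^+ k.
  rewrite /fcoef -!pintZ// -pintD; [|exact: pintegrableZ..].
  have dF x : is_derive x 1 (fun x => h x * trig true k x)
      (s * (h x * trig true k x) + (- k%:R) * (h x * trig (~~ true) k x)).
    have := is_derive_mul (is_derive_expZ s x) (is_derive_cosZ k%:R x).
    by congr is_derive; rewrite /h /trig /negb; ring.
  rewrite (pint_FTC (@ct true _ _) dF).
  by rewrite /trig mulrN cosN !cos_natpi mulrBl.
have e2 : s * fcoef h false k + k%:R * fcoef h true k = 0.
  rewrite /fcoef -!pintZ// -pintD; [|exact: pintegrableZ..].
  have dF x : is_derive x 1 (fun x => h x * trig false k x)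
      (s * (h x * trig false k x) + k%:R * (h x * trig (~~ false) k x)).
    have := is_derive_mul (is_derive_expZ s x) (is_derive_sinZ k%:R x).
    by congr is_derive; rewrite /h /trig /negb; ring.
  rewrite (pint_FTC (@ct false _ _) dF).
  by rewrite /trig mulrN sinN !sin_natpi oppr0 !mulr0 subrr.
have : (J * (-1) ^+ k) ^+ 2 + 0 ^+ 2 = J ^+ 2.
  by rewrite exprMn sqrr_sign mulr1 expr0n addr0.
rewrite -e1 -e2 => <-; rewrite /fpower.
by move: (fcoef _ _ _) (fcoef _ _ _) (k%:R : R) => A B K; ring.
Qed.

(** Bessel's inequality for [exp (s x)].  The subtracted term is the mode
    k = 0, half of which sits on each side of the symmetric sum over all k. *)
Lemma sum_inv_sq_le s N (E := expR (s * pi)) (F := expR (- (s * pi))) : 0 < s ->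
  \sum_(k < N) (k.+1%:R ^+ 2 + s ^+ 2)^-1 <=
  pi * (E + F) / (2 * s * (E - F)) - (2 * s ^+ 2)^-1.
Proof.
move=> s0; pose h := fun x : R => expR (s * x).
have ch : continuous h by exact: continuous_expZ.
have hi : sqintegrable h by exact: sqintegrable_continuous.
have pi0 := pi_gt0 R.
have FE : F < E by rewrite ltr_expR; have := mulr_gt0 s0 pi0; lra.
have h2 : pint (fun x => h x ^+ 2) = (E ^+ 2 - F ^+ 2) / (2 * s).
  have dF x : is_derive x 1 (fun x => (2 * s)^-1 * (h x * h x)) (h x ^+ 2).
    have := is_derive_scal (2 * s)^-1 (is_derive_mul (is_derive_expZ s x)
      (is_derive_expZ s x)).
    by congr is_derive; rewrite /h; field; rewrite gt_eqF.
  have ch2 : continuous (fun x => h x ^+ 2) by move=> x; apply: cvgM; exact: ch.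
  by rewrite (pint_FTC ch2 dF) /h mulrN -/E -/F; field; rewrite gt_eqF.
have := bessel N hi; rewrite h2.
have hp k : fpower h k = (E - F) ^+ 2 / (k%:R ^+ 2 + s ^+ 2).
  have := fpower_exp s k; rewrite -/h -/E -/F => <-.
  by rewrite mulfK// gt_eqF// ltr_wpDl ?sqr_ge0// exprn_gt0.
have h0 : fcoef h true 0 ^+ 2 = (E - F) ^+ 2 / s ^+ 2.
  have := hp 0%N; rewrite expr0n add0r => <-; rewrite /fpower.
  suff -> : fcoef h false 0 = 0 by rewrite expr0n addr0.
  rewrite /fcoef -[RHS](pint_sinZ 0).
  by apply: eq_pint => x _; rewrite /trig mul0r sin0 mulr0.
rewrite h0; under eq_bigr => k _ do rewrite hp -mulrA mulrCA.
rewrite -mulr_suml.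
move: (\sum_(k < N) _) => X.
move: (pi) pi0 E F FE {h ch hi h2 hp h0} => p p0 E F FE h.
have EF0 : 0 < E - F by rewrite subr_gt0.
have c0 : 0 < (E - F) ^+ 2 / p by rewrite divr_gt0// exprn_gt0.
rewrite -(ler_pM2r c0).
have -> : (p * (E + F) / (2 * s * (E - F)) - (2 * s ^+ 2)^-1) * ((E -
  F) ^+ 2 / p) =
    (E ^+ 2 - F ^+ 2) / (2 * s) - (E - F) ^+ 2 / s ^+ 2 / (2 * p).
  by field; rewrite !gt_eqF.
by rewrite lerBrDl.
Qed.

Section SecondOrder.
Variables (nu : R) (h h1 : R -> R).
Hypothesis nu0 : 0 < nu.
Hypothesis dh : forall x, is_derive x 1 h (h1 x).
Hypothesis dh1 : forall x, is_derive x 1 h1 (2 * nu * h1 x - 2 * nu ^+ 2 * h x).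
Hypothesis hper : h (- pi) = h pi.

Let J := h1 pi - h1 (- pi).
Let H := h pi.
Let K := h1 pi + h1 (- pi).

Let ch : continuous h. Proof. exact: is_derive_cont dh. Qed.
Let ch1 : continuous h1. Proof. exact: is_derive_cont dh1. Qed.
Let hi : sqintegrable h. Proof. exact: sqintegrable_continuous. Qed.

(** [k^4 + 4 nu^4] is the squared modulus of [(nu - i k)^2 + nu^2], the symbol
    of the equation for h; since h takes equal values at both ends, only
    the jump J of its derivative contributes. *)
Lemma fpower_second_order k : fpower h k * (k%:R ^+ 4 + 4 * nu ^+ 4) = J ^+ 2.
Proof.
have hti b : pintegrable (fun x => h x * trig b k x).
  by apply: sqintegrable_mul => //; exact: sqintegrable_trig.
have ct b c d : continuous (fun x =>
  c * (h x * trig b k x) + d * (h x * trig (~~ b) k x)).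
  move=> x; apply: cvgD; apply: cvgMr; apply: cvgM; [exact: ch| |exact: ch|];
    exact: continuous_trig.
have e1 : (k%:R ^+ 2 - 2 * nu ^+ 2) * fcoef h true k +
  (2 * nu * k%:R) * fcoef h false k =
    J * (-1) ^+ k.
  rewrite /fcoef -!pintZ// -pintD; [|exact: pintegrableZ..].
  have dF x : is_derive x 1 (fun x =>
    (h1 x * trig true k x + k%:R * (h x * trig false k x)) +
      (- (2 * nu)) * (h x * trig true k x))
      ((k%:R ^+ 2 - 2 * nu ^+ 2) * (h x * trig true k x) +
       (2 * nu * k%:R) * (h x * trig (~~ true) k x)).
    have dc := is_derive_cosZ k%:R x; have ds := is_derive_sinZ k%:R x.
    have := is_derive_add (is_derive_add (is_derive_mul (dh1 x) dc)
      (is_derive_scal k%:R (is_derive_mul (dh x) ds)))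
      (is_derive_scal (- (2 * nu)) (is_derive_mul (dh x) dc)).
    by congr is_derive; rewrite /trig /negb; move: (k%:R : R) => ?; ring.
  rewrite (pint_FTC (@ct true _ _) dF) /trig !mulrN cosN sinN hper cos_natpi
    sin_natpi /J.
  by ring.
have e2 : (k%:R ^+ 2 - 2 * nu ^+ 2) * fcoef h false k +
  (- (2 * nu * k%:R)) * fcoef h true k = 0.
  rewrite /fcoef -!pintZ// -pintD; [|exact: pintegrableZ..].
  have dF x : is_derive x 1 (fun x =>
    (h1 x * trig false k x + (- k%:R) * (h x * trig true k x)) +
      (- (2 * nu)) * (h x * trig false k x))
      ((k%:R ^+ 2 - 2 * nu ^+ 2) * (h x * trig false k x) +
       (- (2 * nu * k%:R)) * (h x * trig (~~ false) k x)).
    have dc := is_derive_cosZ k%:R x; have ds := is_derive_sinZ k%:R x.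
    have := is_derive_add (is_derive_add (is_derive_mul (dh1 x) ds)
      (is_derive_scal (- k%:R) (is_derive_mul (dh x) dc)))
      (is_derive_scal (- (2 * nu)) (is_derive_mul (dh x) ds)).
    by congr is_derive; rewrite /trig /negb; move: (k%:R : R) => ?; ring.
  rewrite (pint_FTC (@ct false _ _) dF) /trig !mulrN cosN sinN hper cos_natpi
    sin_natpi.
  by ring.
have : (J * (-1) ^+ k) ^+ 2 + 0 ^+ 2 = J ^+ 2.
  by rewrite exprMn sqrr_sign mulr1 expr0n addr0.
rewrite -e1 -e2 => <-; rewrite /fpower.
by move: (fcoef _ _ _) (fcoef _ _ _) (k%:R : R) => A B C; ring.
Qed.

(** The equation for h makes [h^2] the derivative of a quadratic form in
    [(h, h1)]; its coefficients solve a linear system. *)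
Lemma pint_sq_second_order : pint (fun x => h x ^+ 2) =
  J * (K / (8 * nu ^+ 3) - H / (2 * nu ^+ 2)).
Proof.
have dF x : is_derive x 1 (fun x => (3 / (4 * nu) * (h x * h x) +
    (- (2 * nu ^+ 2)^-1) * (h x * h1 x)) + (8 * nu ^+ 3)^-1 * (h1 x * h1 x))
      (h x ^+ 2).
  have := is_derive_add (is_derive_add
    (is_derive_scal (3 / (4 * nu)) (is_derive_mul (dh x) (dh x)))
    (is_derive_scal (- (2 * nu ^+ 2)^-1) (is_derive_mul (dh x) (dh1 x))))
    (is_derive_scal (8 * nu ^+ 3)^-1 (is_derive_mul (dh1 x) (dh1 x))).
  by congr is_derive; field; rewrite gt_eqF.
have ch2 : continuous (fun x => h x ^+ 2) by move=> x; apply: cvgM; exact: ch.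
rewrite (pint_FTC ch2 dF) hper /J /K /H.
by move: (h pi) (h1 pi) (h1 (- pi)) => *; field; rewrite gt_eqF.
Qed.

Lemma sum_second_order_le N : 0 < J ^+ 2 ->
  \sum_(k < N) (k.+1%:R ^+ 4 + 4 * nu ^+ 4)^-1 <=
  pi * (K / (8 * nu ^+ 3) - H / (2 * nu ^+ 2)) / J - (8 * nu ^+ 4)^-1.
Proof.
have alg (p J' K' H' X : R) : 0 < p -> 0 < J' ^+ 2 -> J' != 0 ->
    J' ^+ 2 / (4 * nu ^+ 4) / (2 * p) + X * (J' ^+ 2 / p) <=
    J' * (K' / (8 * nu ^+ 3) - H' / (2 * nu ^+ 2)) ->
    X <= p * (K' / (8 * nu ^+ 3) - H' / (2 * nu ^+ 2)) / J' - (8 * nu ^+ 4)^-1.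
  move=> p0 J20 J0 hX.
  have c0 : 0 < J' ^+ 2 / p by rewrite divr_gt0.
  rewrite -(ler_pM2r c0) -subr_ge0.
  have -> : (p * (K' / (8 * nu ^+ 3) - H' / (2 * nu ^+ 2)) / J' -
    (8 * nu ^+ 4)^-1) *
      (J' ^+ 2 / p) - X * (J' ^+ 2 / p) =
      J' * (K' / (8 * nu ^+ 3) - H' / (2 * nu ^+ 2)) -
      (J' ^+ 2 / (4 * nu ^+ 4) / (2 * p) + X * (J' ^+ 2 / p)).
    by field; rewrite J0 !gt_eqF.
  by rewrite subr_ge0.
move=> J20; have J0 : J != 0 by move: J20; rewrite exprn_even_gt0.
have pi0 := pi_gt0 R; have := bessel N hi; rewrite pint_sq_second_order.
have hp k : fpower h k = J ^+ 2 / (k%:R ^+ 4 + 4 * nu ^+ 4).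
  rewrite -(fpower_second_order k) mulfK// gt_eqF// ltr_wpDl ?exprn_ge0//
    mulr_gt0//.
  by rewrite exprn_gt0.
have h0 : fcoef h true 0 ^+ 2 = J ^+ 2 / (4 * nu ^+ 4).
  have := hp 0%N; rewrite expr0n add0r => <-; rewrite /fpower.
  suff -> : fcoef h false 0 = 0 by rewrite [0 ^+ 2]expr0n addr0.
  rewrite /fcoef -[RHS](pint_sinZ 0).
  by apply: eq_pint => x _; rewrite /trig mul0r sin0 mulr0.
rewrite h0; under eq_bigr => k _ do rewrite hp -mulrA mulrCA.
rewrite -mulr_suml; exact: alg.
Qed.

End SecondOrder.

Lemma is_derive_osc nu a b x :
  is_derive x 1 (fun y => expR (nu * y) * (a * cos (nu * y) + b * sin (nu * y)))
    (nu * (expR (nu * x) * ((a + b) * cos (nu * x) + (b - a) * sin (nu * x)))).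
Proof.
have := is_derive_mul (is_derive_expZ nu x) (is_derive_add
  (is_derive_scal a (is_derive_cosZ nu x))
    (is_derive_scal b (is_derive_sinZ nu x))).
by congr is_derive; ring.
Qed.

(** The coefficients a and b of h are chosen so that h takes equal values at
    both ends of the period.  The exact value has
    [(4 s c + E^2 - F^2) / ((E - F)^2 + 4 s^2)] in place of
    [1 + 3 / Delta^2]; the latter is larger because [4 s c <= 4 s^2 + 1] and,
    as [E F = 1], [E^2 - F^2 <= Delta^2 + 2]. *)
Lemma sum_inv_quartic_le nu N (Delta :=
  expR (nu * pi) - expR (- (nu * pi))) : 0 < nu ->
  \sum_(k < N) (k.+1%:R ^+ 4 + 4 * nu ^+ 4)^-1 <=
  pi * (1 + 3 / Delta ^+ 2) / (8 * nu ^+ 3) - (8 * nu ^+ 4)^-1.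
Proof.
move=> nu0; have pi0 := pi_gt0 R; have npi0 := mulr_gt0 nu0 pi0.
set E := expR (nu * pi) in Delta *; set F := expR (- (nu * pi)) in Delta *.
have EF1 : E * F = 1 by rewrite /E /F -expRD subrr expR0.
have FE : F < E by rewrite ltr_expR; lra.
set c := cos (nu * pi); set s := sin (nu * pi).
have cs1 : c ^+ 2 + s ^+ 2 = 1 := cos2Dsin2 _.
(* With these amplitudes h takes the value 2 s c at both ends. *)
pose a := s * (E + F); pose b := - (c * (E - F)).
pose h x := expR (nu * x) * (a * cos (nu * x) + b * sin (nu * x)).
pose h1 x := nu * (expR (nu * x) * ((a + b) * cos (nu * x) +
  (b - a) * sin (nu * x))).
have dh x : is_derive x 1 h (h1 x) by exact: is_derive_osc.
have dh1 x : is_derive x 1 h1 (2 * nu * h1 x - 2 * nu ^+ 2 * h x).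
  have := is_derive_scal nu (is_derive_osc nu (a + b) (b - a) x).
  by congr is_derive; rewrite /h1 /h; ring.
have hpi : h pi = 2 * s * c.
  rewrite /h -/E -/c -/s /a /b; transitivity (E * F * (2 * s * c));
    last by rewrite EF1 mul1r.
  ring.
have hNpi : h (- pi) = h pi.
  rewrite hpi /h mulrN cosN sinN -/F -/c -/s /a /b.
  transitivity (E * F * (2 * s * c)); last by rewrite EF1 mul1r.
  ring.
have hJ : h1 pi - h1 (- pi) = - nu * ((E - F) ^+ 2 + 4 * s ^+ 2).
  have EF4 : (E + F) ^+ 2 = (E - F) ^+ 2 + 4.
    by transitivity ((E - F) ^+ 2 + 4 * (E * F)); [ring|rewrite EF1 mulr1].
  transitivity (- nu * (c ^+ 2 * (E - F) ^+ 2 + s ^+ 2 * (E + F) ^+ 2)).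
    by rewrite /h1 mulrN cosN sinN -/E -/F -/c -/s /a /b; ring.
  rewrite EF4; transitivity (- nu * ((c ^+ 2 + s ^+ 2) * (E - F) ^+ 2 +
    4 * s ^+ 2)).
    by ring.
  by rewrite cs1 mul1r.
have hK : h1 pi + h1 (- pi) = nu * (4 * s * c - (E ^+ 2 - F ^+ 2)).
  transitivity (nu * (4 * (E * F) * s * c - (c ^+ 2 +
    s ^+ 2) * (E ^+ 2 - F ^+ 2))).
    by rewrite /h1 mulrN cosN sinN -/E -/F -/c -/s /a /b; ring.
  by rewrite EF1 cs1 mul1r mulr1.
have alg (p Q D2 : R) : 0 < D2 -> p * (nu * (4 * s * c - Q) / (8 * nu ^+ 3) -
    2 * s * c / (2 * nu ^+ 2)) / (- nu * D2) =
    (p / (8 * nu ^+ 3)) * ((4 * s * c + Q) / D2).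
  by move=> D20; field; rewrite !gt_eqF.
have D0 : 0 < Delta by rewrite /Delta subr_gt0.
have Ds : 0 < Delta ^+ 2 + 4 * s ^+ 2.
  by rewrite ltr_pwDl ?exprn_gt0// mulr_ge0 ?sqr_ge0.
have J0 : 0 < (h1 pi - h1 (- pi)) ^+ 2.
  by rewrite hJ exprn_even_gt0//= mulf_neq0 ?oppr_eq0// gt_eqF.
apply: (le_trans (sum_second_order_le nu0 dh dh1 hNpi N J0)).
rewrite hJ hK hpi -/Delta lerD2r.
have -> : pi * (nu * (4 * s * c - (E ^+ 2 - F ^+ 2)) / (8 * nu ^+ 3) -
    2 * s * c / (2 * nu ^+ 2)) / (- nu * (Delta ^+ 2 + 4 * s ^+ 2)) =
    (pi / (8 * nu ^+ 3)) * ((4 * s * c + (E ^+ 2 - F ^+ 2)) / (Delta ^+ 2 +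
      4 * s ^+ 2)).
  exact: alg.
rewrite [leRHS](_ : _ = (pi / (8 * nu ^+ 3)) * (1 + 3 / Delta ^+ 2));
  last first.
  by rewrite mulrAC.
rewrite ler_wpM2l//; first by rewrite divr_ge0 ?mulr_ge0 ?exprn_ge0// ltW.
have F0 : 0 < F by exact: expR_gt0.
have num : 4 * s * c + (E ^+ 2 - F ^+ 2) <= Delta ^+ 2 + 4 * s ^+ 2 + 3.
  have -> : E ^+ 2 - F ^+ 2 = Delta ^+ 2 + 2 * (E * F) -
    2 * F ^+ 2 by rewrite /Delta; ring.
  have : 4 * s * c <= 4 * s ^+ 2 + (c ^+ 2 + s ^+ 2).
    have := sqr_ge0 (2 * s - c); have := sqr_ge0 s; move=> *; nra.
  by rewrite EF1 cs1; have := sqr_ge0 F; move=> *; lra.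
rewrite ler_pdivrMr//; apply: (le_trans num).
have q0 : 0 < 3 / Delta ^+ 2 by rewrite divr_gt0// exprn_gt0.
have -> : (1 + 3 / Delta ^+ 2) * (Delta ^+ 2 + 4 * s ^+ 2) =
    Delta ^+ 2 + 4 * s ^+ 2 + 3 + 3 / Delta ^+ 2 * (4 * s ^+ 2).
  by field; rewrite gt_eqF.
by rewrite lerDl mulr_ge0 ?(ltW q0)// mulr_ge0 ?sqr_ge0.
Qed.

End ExplicitSums.

(** * Choice of the shift *)

Section Numerics.
Context {R : realType}.
Implicit Types x y z p : R.

Lemma expR_ge_sum n x : 0 <= x -> \sum_(k < n) x ^+ k / k`!%:R <= expR x.
Proof.
move=> x0; have := nondecreasing_cvgn_le (u_ :=
  series (exp_coeff x)) _ (is_cvg_series_exp_coeff x) n.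
rewrite /series/= big_mkord => h; rewrite /expR; apply: le_trans (h _).
  by rewrite le_eqVlt; apply/orP; left; apply/eqP/eq_bigr => k _.
by apply: nondecreasing_series => k _ _; rewrite exp_coeff_ge0.
Qed.

Lemma sin_le x : 0 <= x -> sin x <= x.
Proof.
move=> x0; have [c cx] : exists2 c, c \in `[0,
  x] & sin x - sin 0 = cos c * (x - 0).
  by apply: MVT_segment => //; exact/continuous_subspaceT/continuous_sin.
by rewrite sin0 !subr0 => ->; rewrite ler_piMl// cos_le1.
Qed.

(** From [cos x = 1 - 2 sin^2 (x/2)] and [sin t <= t]; where [sin (x/2)] may be
    negative, that is beyond 4, the left-hand side is below -1. *)
Lemma cos_ge x : 0 <= x -> 1 - x ^+ 2 / 2 <= cos x.
Proof.
move=> x0; have -> : cos x = 1 - 2 * sin (x / 2) ^+ 2.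
  have -> : cos x = cos (x / 2 + x / 2) by congr cos; field.
  by rewrite cosD -!expr2 cos2sin2; ring.
have [x4|x4] := leP 4 x.
  have := sin_le1 (x / 2); have := sin_geN1 (x / 2).
  by move: (sin _) => s *; nra.
have x2 : 0 <= x / 2 by lra.
have := sin_le x2; have : 0 <= sin (x / 2).
  have [->|xn0] := eqVneq x 0; first by rewrite mul0r sin0.
  apply/ltW/sin2_gt0; have x0' : 0 < x by rewrite lt_neqAle eq_sym xn0.
  by apply/andP; split; lra.
by move: (sin _) => s *; nra.
Qed.

(** [cos (3/2) > 0], by [cos_ge] at 3/4 and the duplication formula. *)
Lemma pi_ge3 : 3 <= pi :> R.
Proof.
rewrite leNgt; apply/negP => pi3.
have c34 : 2^-1 < cos (3 / 4 : R) ^+ 2.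
  have : 1 - (3 / 4) ^+ 2 / 2 <= cos (3 / 4 : R) by apply: cos_ge; lra.
  by move: (cos _) => c h; nra.
have c32 : 0 < cos (3 / 2 : R).
  have -> : cos (3 / 2 : R) = cos (3 / 4 + 3 / 4 : R) by congr cos; field.
  by rewrite cosD -!expr2 sin2cos2; lra.
have : cos (3 / 2 : R) <= cos (pi / 2).
  have p2 := pi_ge2 R; rewrite ltW// ltr_cos ?in_itv/=; lra.
by rewrite cos_pihalf; lra.
Qed.

(** With [y = pi s = pi D - 1] the claim reduces to
    [2 y (2 y^2 + 2 y + 1) <= (y + 1) (exp (2 y) - 1)], which follows from the
    Taylor polynomial of degree 4 since y >= 1. *)
Lemma exists_shift_H1 (D : R) : 1 <= D -> exists s T : R, [/\ 0 < s,
  forall N, \sum_(k < N) (k.+1%:R ^+ 2 + s ^+ 2)^-1 <= T &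
  T * (D ^+ 2 + s ^+ 2) / pi <= D - 1 / pi].
Proof.
move=> D1; have pi0 := pi_gt0 R; have pi3 := pi_ge3.
pose y := D * pi - 1; have y1 : 1 <= y by rewrite /y; nra.
pose s := y / pi; have s0 : 0 < s by rewrite divr_gt0//; lra.
exists s; exists (pi * (expR y + expR (- y)) / (2 * s * (expR y - expR (- y))) -
  (2 * s ^+ 2)^-1).
split => //.
  move=> N; have := sum_inv_sq_le N s0.
  by have -> : s * pi = y by rewrite divfK// gt_eqF.
have DE : D = (y + 1) / pi by rewrite /y addrNK mulfK// gt_eqF.
have EF : expR y * expR (- y) = 1 by rewrite -expRD subrr expR0.
have FE : expR (- y) < expR y by rewrite ltr_expR; lra.
have E2 : 1 + (2 * y) + (2 * y) ^+ 2 / 2 + (2 * y) ^+ 3 / 6 +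
  (2 * y) ^+ 4 / 24 <= expR y ^+ 2.
  have -> : expR y ^+ 2 = expR (2 * y) by rewrite expr2 -expRD; congr expR;
    ring.
  have := @expR_ge_sum 5 (2 * y); rewrite !big_ord_recr big_ord0/= expr0 expr1
    add0r !divr1.
  by apply; lra.
have E0 := expR_gt0 (- y).
move: (expR y) (expR (- y)) EF FE E2 E0 => E F EF FE E2 E0.
(* What is left is an inequality in y and E, with pi as a scale that cancels. *)
rewrite DE /s; clear D1 pi3 s s0 DE; move: y y1 E2 (pi) pi0 => y y1 E2 p p0.
have -> : (p * (E + F) / (2 * (y / p) * (E - F)) - (2 * (y / p) ^+ 2)^-1) *
    (((y + 1) / p) ^+ 2 + (y / p) ^+ 2) / p =
    ((y * ((E + F) / (E - F)) - 1) * (2 * y ^+ 2 + 2 * y +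
      1) / (2 * y ^+ 2)) / p.
  by field; rewrite !gt_eqF//; lra.
have -> : (y + 1) / p - 1 / p = y / p by field; rewrite gt_eqF.
rewrite ler_pM2r ?invr_gt0// ler_pdivrMr; last by nra.
have -> : (E + F) / (E - F) = 1 + 2 / (E ^+ 2 - 1).
  have -> : 2 / (E ^+ 2 - 1) = 2 * F / (E - F).
    have <- : (E - F) * E = E ^+ 2 - 1 by rewrite -EF; ring.
    have -> : 2 / ((E - F) * E) = 2 * (E * F) / ((E -
      F) * E) by rewrite EF mulr1.
    by field; rewrite !gt_eqF//; lra.
  by field; rewrite gt_eqF//; lra.
have E21 : 0 < E ^+ 2 - 1 by nra.
rewrite -subr_ge0.
have -> : y * (2 * y ^+ 2) - (y * (1 + 2 / (E ^+ 2 - 1)) - 1) * (2 * y ^+ 2 +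
  2 * y + 1) =
   ((y + 1) * (E ^+ 2 - 1) - 2 * y * (2 * y ^+ 2 + 2 * y + 1)) / (E ^+ 2 - 1).
  by field; rewrite gt_eqF.
apply: divr_ge0; last exact: ltW.
apply: (@le_trans _ _ ((y + 1) * (2 * y + (2 * y) ^+ 2 / 2 + (2 * y) ^+ 3 / 6 +
  (2 * y) ^+ 4 / 24) - 2 * y * (2 * y ^+ 2 + 2 * y + 1))).
  nra.
rewrite lerD2r ler_wpM2l; lra.
Qed.

(** Expanded at 12/5, the difference of the two sides has nonnegative
    coefficients. *)
Lemma quartic_margin z : 12 / 5 <= z ->
  3 * (4 * z ^+ 4 + 4 / 3 * z ^+ 3 + 2 / 3 * z ^+ 2 + 4 / 27 * z + 1 / 81) <=
  (2 / 3 * z ^+ 2 + 14 / 27 * z + 11 / 81) *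
  (1 + 2 * z + 2 * z ^+ 2 + 4 / 3 * z ^+ 3 + 2 / 3 * z ^+ 4 + 4 / 15 * z ^+ 5 +
   4 / 45 * z ^+ 6 - 2).
Proof.
move=> zge; pose t := z - 12 / 5; have t0 : 0 <= t by rewrite /t subr_ge0.
have -> : z = t + 12 / 5 by rewrite /t subrK.
move: t t0 => t t0.
have t2 : 0 <= t ^+ 2 by exact: exprn_ge0.
have t3 : 0 <= t ^+ 3 by exact: exprn_ge0.
have t4 : 0 <= t ^+ 4 by exact: exprn_ge0.
have t5 : 0 <= t ^+ 5 by exact: exprn_ge0.
have t6 : 0 <= t ^+ 6 by exact: exprn_ge0.
have t7 : 0 <= t ^+ 7 by exact: exprn_ge0.
have t8 : 0 <= t ^+ 8 by exact: exprn_ge0.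
lra.
Qed.

(** The proof uses [sig = kappa rho], [z = pi sig - 1/3] and [nu = z / pi].
    The terms of [T (rho^4 + lam) / pi] without exponentials stay below the
    right-hand side by a margin of relative order [z^-2], and
    [quartic_margin] compares this margin with [3 / Delta^2]. *)
Lemma exists_shift_H2 (rho kappa : R) : 1 <= rho -> 0 < kappa ->
  kappa ^+ 4 = 3 / 4 ->
  exists lam T : R, [/\ 0 <= lam,
  forall N, \sum_(k < N) (k.+1%:R ^+ 4 + lam)^-1 <= T &
  T * (rho ^+ 4 + lam) / pi <= 2 / 3 * (kappa * rho) - 2 / (3 * pi)].
Proof.
move=> rho1 k0 k4; have pi0 := pi_gt0 R; have pi3 := pi_ge3.
have k93 : 93 / 100 <= kappa.
  rewrite leNgt; apply/negP => kl; have k2 : kappa ^+ 2 < 8649 / 10000 by nra.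
  have : kappa ^+ 4 < 8649 / 10000 * (8649 / 10000).
    by rewrite (_ : kappa ^+ 4 = kappa ^+ 2 * kappa ^+ 2);
      [have := sqr_ge0 kappa; nra|ring].
  by rewrite k4; lra.
pose sig := kappa * rho; have sig93 : 93 / 100 <= sig by rewrite /sig; nra.
pose z := sig * pi - 1 / 3; have z12 : 12 / 5 <= z by rewrite /z; nra.
pose nu := z / pi; have nu0 : 0 < nu by rewrite divr_gt0//; lra.
pose Delta := expR z - expR (- z).
exists (4 * nu ^+ 4), (pi * (1 + 3 / Delta ^+ 2) / (8 * nu ^+ 3) -
  (8 * nu ^+ 4)^-1).
split; first by rewrite mulr_ge0// exprn_ge0// ltW.
  move=> N; have := sum_inv_quartic_le N nu0.
  by have -> : nu * pi = z by rewrite divfK// gt_eqF.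
have rho4 : rho ^+ 4 = 4 / 3 * sig ^+ 4 by rewrite /sig exprMn k4; field.
have sigE : sig = (z + 1 / 3) / pi by rewrite /z subrK mulfK// gt_eqF.
rewrite -/sig rho4 sigE /nu.
have EF : expR z * expR (- z) = 1 by rewrite -expRD subrr expR0.
have D2 : 1 + 2 * z + 2 * z ^+ 2 + 4 / 3 * z ^+ 3 + 2 / 3 * z ^+ 4 +
  4 / 15 * z ^+ 5 +
   4 / 45 * z ^+ 6 - 2 <= Delta ^+ 2.
  apply: (@le_trans _ _ (expR z ^+ 2 - 2 * (expR z * expR (- z)))); last first.
    by rewrite /Delta; have := sqr_ge0 (expR (- z));
      move: (expR z) (expR (- z)) => E F; nra.
  rewrite EF mulr1 lerD2r (_ : expR z ^+ 2 = expR (2 * z)); last first.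
    by rewrite expr2 -expRD; congr expR; ring.
  have := @expR_ge_sum 7 (2 * z); rewrite !big_ord_recr big_ord0/= expr0 expr1
    add0r !divr1.
  move=> h; apply: le_trans (h _); last lra.
  rewrite !exprMn /factorial/=; move: (z) => z'; lra.
have margin := quartic_margin z12.
clear rho1 k0 k4 k93 pi3 sig93 nu0 rho4 sigE EF.
have {D2} : (3 * (4 * z ^+ 4 + 4 / 3 * z ^+ 3 + 2 / 3 * z ^+ 2 + 4 / 27 * z +
  1 / 81) <=
  (2 / 3 * z ^+ 2 + 14 / 27 * z + 11 / 81) * Delta ^+ 2).
  apply: (le_trans margin); rewrite ler_wpM2l//.
  by have := sqr_ge0 z; lra.
clear margin; have D0 : 0 < Delta ^+ 2.
  by rewrite exprn_gt0// /Delta subr_gt0 ltr_expR; lra.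
move: D0; move: (Delta ^+ 2) => Q Q0; clear Delta.
clear nu; clearbody z; clear sig; move: (pi) pi0 => p p0 h.
have z0 : 0 < z by lra.
have -> : (p * (1 + 3 / Q) / (8 * (z / p) ^+ 3) - (8 * (z / p) ^+ 4)^-1) *
   (4 / 3 * ((z + 1 / 3) / p) ^+ 4 + 4 * (z / p) ^+ 4) / p =
   ((4 / 3 * (z + 1 / 3) ^+ 4 + 4 * z ^+ 4) * (z * (1 +
     3 / Q) - 1) / (8 * z ^+ 4)) / p.
  by field; rewrite !gt_eqF.
have -> : 2 / 3 * ((z + 1 / 3) / p) - 2 / (3 * p) = (2 / 3 * (z - 2 / 3)) / p.
  by field; rewrite gt_eqF.
rewrite ler_pM2r ?invr_gt0// ler_pdivrMr ?mulr_gt0 ?exprn_gt0// -subr_ge0.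
have -> : 2 / 3 * (z - 2 / 3) * (8 * z ^+ 4) -
  (4 / 3 * (z + 1 / 3) ^+ 4 + 4 * z ^+ 4) * (z * (1 + 3 / Q) - 1) =
  (4 / 3) * z * ((2 / 3 * z ^+ 2 + 14 / 27 * z + 11 / 81) * Q -
     3 * (4 * z ^+ 4 + 4 / 3 * z ^+ 3 + 2 / 3 * z ^+ 2 + 4 / 27 * z +
       1 / 81)) / Q + 4 / 243.
  by field; rewrite gt_eqF.
by rewrite addr_ge0// divr_ge0 ?(ltW Q0)// mulr_ge0 ?subr_ge0//; lra.
Qed.

End Numerics.

(** * Norms on the circle *)

Section TorusNorms.
Context {R : realType}.
Local Notation mu := (@lebesgue_measure R).
Local Notation D := (`[- pi, pi]%classic : set (measurableTypeR R)).
Local Notation tm := (@torus_measure R).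

Lemma torus_measureE (A : set (measurableTypeR R)) : tm A = mu (A `&` D).
Proof. by []. Qed.

Lemma torus_measure_gt0 : (0 < tm [set: _])%E.
Proof.
rewrite torus_measureE setTI [X in (_ < X)%E]period_measure lte_fin.
by rewrite mulr2n; have := pi_gt0 R; lra.
Qed.

Lemma ge0_integral_torus (f : R -> \bar R) :
  measurable_fun [set: measurableTypeR R] f -> (forall x, (0 <= f x)%E) ->
  (\int[tm]_x f x = \int[mu]_(x in D) f x)%E.
Proof.
move=> mf f0.
have mD : measurable (~` D) by apply: measurableC; exact: mperiod.
rewrite (@ge0_negligible_integral _ _ _ tm setT (~` D))//; last first.
  by rewrite torus_measureE setICl measure0.
rewrite setTD setCK; apply: eq_measure_integral => A mA AD.
by rewrite torus_measureE setIidl.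
Qed.

Lemma sqintegrable_L2_torus (u : R -> R) : periodic u (pi *+ 2) ->
  measurable_fun [set: measurableTypeR R] u -> sqintegrable u -> L2_torus u.
Proof.
move=> pu mu_ [_ ui]; split => //; rewrite inE; apply/andP; split;
  rewrite inE//=.
rewrite /finite_norm unlock poweR_lty// ge0_integral_torus//.
- have /integrableP[_] := ui; apply: le_lt_trans; rewrite le_eqVlt; apply/orP;
  left.
  by apply/eqP/eq_integral => x _ /=; rewrite powR_mulrn// -normrX.
- apply/measurable_EFinP; apply: (measurableT_comp (measurable_powR _)).
  exact: measurableT_comp.
- by move=> x /=; rewrite lee_fin powR_ge0.
Qed.

Lemma L2_torus_measurable (u : R -> R) : L2_torus u ->
  measurable_fun [set: measurableTypeR R] u.
Proof. by move=> [_]; rewrite inE => /andP[]; rewrite inE. Qed.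

Lemma L2_torus_sqintegrable (u : R -> R) : L2_torus u -> sqintegrable u.
Proof.
move=> u2; have um := L2_torus_measurable u2; have [_ ui] := u2.
split; first exact: measurable_funTS.
have /integrableP[_ iu] := Lfun2_integrable_sqr ui.
apply/integrableP; split.
  by apply/measurable_EFinP/measurable_funTS; exact: measurable_funX.
rewrite -ge0_integral_torus//.
by do 2 apply: measurableT_comp => //; exact: measurable_funX.
Qed.

Lemma L2norm_pint (u : R -> R) : L2_torus u ->
  L2norm u = (Num.sqrt (pint (fun x => u x ^+ 2)))%:E.
Proof.
move=> u2; have um := L2_torus_measurable u2;
  have [_ ui] := L2_torus_sqintegrable u2.
rewrite /L2norm unlock ge0_integral_torus//; last 2 first.
- apply/measurable_EFinP; apply: (measurableT_comp (measurable_powR _)).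
  exact: measurableT_comp.
- by move=> x /=; rewrite lee_fin powR_ge0.
have -> : (\int[mu]_(x in D) `|(EFin \o u) x| `^ 2)%E = (pint (fun x =>
  u x ^+ 2))%:E.
  rewrite /pint /Rintegral fineK; last exact: (integrable_fin_num (@mperiod R)
    ui).
  apply: eq_integral => x _ /=.
  by rewrite powR_mulrn// -normrX ger0_norm// sqr_ge0.
rewrite poweR12_sqrt//= lee_fin; apply: pint_ge0 => x; exact: sqr_ge0.
Qed.

Lemma Linfnorm_le (u : R -> R) (M : R) :
  {ae mu, forall x, - pi < x < pi -> `|u x| <= M} -> (Linfnorm u <= M%:E)%E.
Proof.
move=> uM; rewrite /Linfnorm unlock torus_measure_gt0.
apply/ess_supP.
have [N [mN N0 sub]] : {ae mu, forall x, - pi <= x <= pi -> `|u x| <= M}.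
  (* The end points of the period are negligible. *)
  apply: ae_imply2 uM (@ae_imply2 _ _ _ (fun x =>
    x <> - pi /\ x <> pi) _ (ae_neq (- pi)) (ae_neq pi)).
    move=> x h [x1 x2] /andP[x3 x4]; apply: h; rewrite !lt_neqAle x3 x4 !andbT.
    by apply/andP; split; apply/eqP => // /esym.
  by move=> x; split.
exists (N `|` ~` D); split.
- by apply: measurableU => //; apply: measurableC; exact: mperiod.
- rewrite torus_measureE setIUl setICl setU0; apply/eqP.
  rewrite -measure_le0 -N0; apply: le_measure; rewrite ?inE//.
  by apply: measurableI => //; exact: mperiod.
move=> x /= h; have [xD|xD] := pselect (D x); last by right.
left; apply: sub => /= h'; apply: h; rewrite lee_fin; apply: h'.
by move: xD; rewrite /= in_itv.
Qed.

End TorusNorms.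

(** * The two inequalities *)

Section UpperBounds.
Context {R : realType}.
Local Notation mu := (@lebesgue_measure R).
Implicit Types (u v : R -> R).

Lemma Linfnorm_ge0 u : (0 <= Linfnorm u)%E.
Proof. exact: Lnorm_ge0. Qed.

Lemma Linfnorm_sq_le u (M : R) :
  {ae mu, forall x, - pi < x < pi -> `|u x| <= M} ->
    (Linfnorm u ^+ 2 <= (M ^+ 2)%:E)%E.
Proof.
move=> /Linfnorm_le h; have u0 := Linfnorm_ge0 u.
by rewrite expe2 expr2 EFinM; apply: lee_pmul.
Qed.

(** If the shift and the lattice sum bound can be chosen for every ratio
    [D >= 1], the multiplier bound with [D = B / A] gives the inequality.  When
    [A = 0] all coefficients vanish. *)
Lemma interpolation_of_shift u v (W : nat -> R) (rhs : R -> R) :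
  sqintegrable u -> sqintegrable v -> pint u = 0 ->
  (forall k, 1 <= W k) ->
  (forall k, fpower v k.+1 = W k * fpower u k.+1) ->
  (forall D, 1 <= D -> exists lam T : R, [/\ 0 <= lam,
    forall N, \sum_(k < N) (W k + lam)^-1 <= T & T * (D ^+ 2 + lam) / pi <=
      rhs D]) ->
  let A := Num.sqrt (pint (fun x => u x ^+ 2)) in
  let B := Num.sqrt (pint (fun x => v x ^+ 2)) in
  exists2 M : R, M ^+ 2 <= A ^+ 2 * rhs (B / A) &
    {ae mu, forall x, - pi < x < pi -> `|u x| <= M}.
Proof.
move=> ui vi u0 W1 uv hW A B.
have uc : fcoef u true 0 = 0.
  by rewrite -[RHS]u0; apply: eq_pint => x _; rewrite /trig mul0r cos0 mulr1.
have a0 : 0 <= pint (fun x => u x ^+ 2) by apply: pint_ge0 => x; exact: sqr_ge0.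
have b0 : 0 <= pint (fun x => v x ^+ 2) by apply: pint_ge0 => x; exact: sqr_ge0.
have A2 : pint (fun x => u x ^+ 2) = A ^+ 2 by rewrite sqr_sqrtr.
have B2 : pint (fun x => v x ^+ 2) = B ^+ 2 by rewrite sqr_sqrtr.
have [A0|An0] := eqVneq A 0.
  exists 0; first by rewrite expr0n A0 expr0n mul0r.
  apply: (fourier_sup_bound ui uc) => N; rewrite mulr0 big1// => k _.
  have F0 (j : 'I_N) : true -> 0 <= fpower u j.+1 / pi.
    by move=> _; rewrite divr_ge0 ?fpower_ge0// pi_ge0.
  have := bessel N ui; rewrite A2 A0 expr0n => h.
  have /psumr_eq0P/(_ k isT) : \sum_(j < N) fpower u j.+1 / pi = 0.
    apply/eqP; rewrite eq_le sumr_ge0// andbT (le_trans _ h)// lerDr.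
    by rewrite divr_ge0 ?sqr_ge0// mulr_ge0// pi_ge0.
  move=> /(_ F0)/eqP; rewrite mulf_eq0 invr_eq0 (gt_eqF (pi_gt0 R)) orbF =>
    /eqP ->.
  by rewrite sqrtr0.
have Ap : 0 < A by rewrite lt_neqAle eq_sym An0 sqrtr_ge0.
have D1 : 1 <= B / A.
  have [lam [T [lam0 hT _]]] := hW 1 (lexx _).
  rewrite ler_pdivlMr// mul1r ler_wsqrtr//.
  exact: (multiplier_sq_le ui vi uc W1 lam0 uv hT).
have [lam [T [lam0 hT hr]]] := hW _ D1.
exists (Num.sqrt (T * (B ^+ 2 + lam * A ^+ 2) / pi)); last first.
  by have := multiplier_sup_bound ui vi uc W1 lam0 uv hT; rewrite A2 B2.
have T0 : 0 <= T by apply: le_trans (hT 0%N); rewrite big_ord0.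
rewrite sqr_sqrtr; last first.
  by rewrite divr_ge0 ?pi_ge0// mulr_ge0// addr_ge0 ?sqr_ge0// mulr_ge0
    ?sqr_ge0.
have -> : T * (B ^+ 2 + lam * A ^+ 2) / pi =
  A ^+ 2 * (T * ((B / A) ^+ 2 + lam) / pi).
  have := gt_eqF (pi_gt0 R); move: (pi : R) => p p0.
  by field; rewrite p0 An0.
by rewrite ler_wpM2l ?sqr_ge0.
Qed.

Lemma interpolation_H1_holds : interpolation_H1 (1 : R) (1 / pi).
Proof.
move=> u v [u2 _] u0 v2 uv.
have ui := L2_torus_sqintegrable u2; have vi := L2_torus_sqintegrable v2.
have := @interpolation_of_shift u v (fun k => k.+1%:R ^+ 2) (fun D =>
  D - 1 / pi) ui vi u0.
case.
- by move=> k; rewrite exprn_ege1// ler1n.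
- by move=> k; exact: weak1_fpower.
- move=> D D1; have [s [T [s0 hT hr]]] := exists_shift_H1 D1.
  by exists (s ^+ 2), T; split => //; exact: sqr_ge0.
move=> M MM /Linfnorm_sq_le h; apply: (le_trans h).
rewrite (L2norm_pint u2) (L2norm_pint v2).
move: MM; move: (Num.sqrt _) (Num.sqrt _) => B A MM.
rewrite mul1e expe2 -!EFinM -EFinB lee_fin; apply: (le_trans MM).
have [->|A0] := eqVneq A 0; first by rewrite expr0n !mul0r mulr0 subrr.
rewrite le_eqVlt; apply/orP; left; apply/eqP.
have := gt_eqF (pi_gt0 R); move: (pi : R) => p p0.
by field; rewrite p0 A0.
Qed.

(** Only the fourth power of the constant enters the computations. *)
Lemma leading_constant_H2_pow4 (C :=
  Num.sqrt 2 / (27 `^ (1 / 4)) : R) : 0 < C /\ C ^+ 4 = 4 / 27.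
Proof.
have p27 : 0 < (27 `^ (1 / 4) : R) by exact: powR_gt0.
split; first by rewrite divr_gt0// sqrtr_gt0.
have e27 : (27 `^ (1 / 4) : R) ^+ 4 = 27.
  by rewrite -powR_mulrn ?powR_ge0// -powRrM mul1r mulVf// powRr1.
rewrite exprMn exprVn e27.
by rewrite (exprM _ 2 2) sqr_sqrtr//; field.
Qed.

Lemma interpolation_H2_holds :
  interpolation_H2 (Num.sqrt 2 / (27 `^ (1 / 4)) : R) (2 / (3 * pi)).
Proof.
have [] := leading_constant_H2_pow4; set C := Num.sqrt 2 / _ => C0 C4.
move=> u v [u2 _] u0 v2 uv.
have ui := L2_torus_sqintegrable u2; have vi := L2_torus_sqintegrable v2.
have := @interpolation_of_shift u v (fun k => k.+1%:R ^+ 4)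
  (fun D => C * Num.sqrt D - 2 / (3 * pi)) ui vi u0.
case.
- by move=> k; rewrite exprn_ege1// ler1n.
- by move=> k; exact: weak2_fpower.
- move=> D D1; have D0 : 0 <= D by apply: le_trans D1.
  have := @exists_shift_H2 R (Num.sqrt D) (3 / 2 * C); case.
  + by rewrite -sqrtr1 ler_wsqrtr.
  + by rewrite mulr_gt0.
  + by rewrite exprMn C4; field.
  move=> lam [T [lam0 hT hr]]; exists lam, T; split => //.
  rewrite -{1}(sqr_sqrtr D0) -exprM (le_trans hr)// lerD2r.
  by rewrite le_eqVlt; apply/orP; left; apply/eqP; field.
move=> M MM /Linfnorm_sq_le h; apply: (le_trans h).
rewrite (L2norm_pint u2) (L2norm_pint v2) !poweR_EFin.
have := sqrtr_ge0 (pint (fun x => u x ^+ 2)).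
have := sqrtr_ge0 (pint (fun x => v x ^+ 2)).
move: MM; move: (Num.sqrt (pint _)) (Num.sqrt (pint _)) => B A MM B0 A0.
rewrite expe2 -!EFinM -EFinB lee_fin; apply: (le_trans MM).
have [->|An0] := eqVneq A 0.
  by rewrite expr0n !mul0r mulr0 powR0 ?mul0r ?mulr0 ?subrr.
have Ap : 0 < A by rewrite lt_neqAle eq_sym An0.
have -> : A `^ (3 / 2) = A * Num.sqrt A.
  have -> : 3 / 2 = 1 + 2^-1 :> R by field.
  by rewrite powRD ?An0 ?implybT// powRr1// powR12_sqrt.
rewrite div1r powR12_sqrt// sqrtrM// sqrtrV//.
have sA : Num.sqrt A != 0 by rewrite gt_eqF// sqrtr_gt0.
have -> : A * Num.sqrt A * Num.sqrt B = A ^+ 2 * (Num.sqrt B / Num.sqrt A).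
  by rewrite -{1 3}(sqr_sqrtr A0); field.
rewrite le_eqVlt; apply/orP; left; apply/eqP.
by move: (2 / _); move=> ?; ring.
Qed.

End UpperBounds.

(** * Even and odd periodic extensions *)

Section PiecewiseIntegral.
Context {R : realType}.
Local Notation mu := (@lebesgue_measure R).
Local Notation D := (`[- pi, pi]%classic : set (measurableTypeR R)).
Implicit Types (f g h F G H phi u v : R -> R).

Lemma itv_FTC (a b : R) g G : a < b -> continuous g ->
  (forall x : R, is_derive x 1 G (g x)) ->
    \int[mu]_(x in `[a, b]) g x = G b - G a.
Proof.
move=> ab cg dG; rewrite /Rintegral (@continuous_FTC2 _ g G)//.
- exact: continuous_subspaceT.
- have cG := is_derive_cont dG.
  split; first by move=> x _; case: (dG x).
  + by apply: cvg_at_right_filter; exact: cG.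
  + by apply: cvg_at_left_filter; exact: cG.
- by move=> x _; rewrite derive1E; have [_] := dG x.
Qed.

Lemma itv_eq_FTC (a b : R) f g G : a < b ->
  mu.-integrable `[a, b] (EFin \o f) ->
  (forall x, a < x < b -> f x = g x) -> continuous g ->
  (forall x : R, is_derive x 1 G (g x)) ->
    \int[mu]_(x in `[a, b]) f x = G b - G a.
Proof.
move=> ab fi fg cg dG; rewrite -(itv_FTC ab cg dG).
have gi : mu.-integrable `[a, b] (EFin \o g).
  apply: continuous_compact_integrable; first exact: segment_compact.
  exact: continuous_subspaceT.
have oc (k : R -> R) : mu.-integrable `[a, b] (EFin \o k) ->
    \int[mu]_(x in `[a, b]) k x = \int[mu]_(x in `]a, b[) k x.
  move=> ki; rewrite -Rintegral_itv_obnd_cbnd; last first.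
    apply: integrableS ki => //; exact: subset_itv_oc_cc.
  rewrite Rintegral_itv_bndo_bndc//.
  apply: integrableS ki => //; exact: subset_itv_oo_cc.
rewrite !oc//; apply: eq_Rintegral => x; rewrite inE/= in_itv/=; exact: fg.
Qed.

(** f may have jumps at 0 and at the ends of the period, so that the
    fundamental theorem of calculus applies to each half separately. *)
Lemma pint_split f g h G H : pintegrable f ->
  (forall x, 0 < x < pi -> f x = g x) -> (forall x, - pi < x < 0 ->
    f x = h x) ->
  continuous g -> continuous h ->
  (forall x : R, is_derive x 1 G (g x)) ->
    (forall x : R, is_derive x 1 H (h x)) ->
  pint f = (G pi - G 0) + (H 0 - H (- pi)).
Proof.
move=> fi fg fh cg ch dG dH; have pi0 := pi_gt0 R.
have fi1 : mu.-integrable `[0, pi] (EFin \o f).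
  apply: integrableS fi => //; apply: subset_itvr; rewrite bnd_simp; lra.
have fi2 : mu.-integrable `[- pi, 0] (EFin \o f).
  apply: integrableS fi => //; apply: subset_itvl; rewrite bnd_simp; lra.
rewrite -(itv_eq_FTC pi0 fi1 fg cg dG).
have Npi0 : - pi < 0 :> R by lra.
rewrite -(itv_eq_FTC Npi0 fi2 fh ch dH).
apply/eqP; rewrite -subr_eq; apply/eqP.
rewrite Rintegral_itvB//; [|by rewrite bnd_simp ltW|by rewrite bnd_simp ltW].
rewrite Rintegral_itv_obnd_cbnd//.
by apply: integrableS fi1 => //; exact: subset_itv_oc_cc.
Qed.

End PiecewiseIntegral.

Section Periodization.
Context {R : realType}.
Local Notation mu := (@lebesgue_measure R).
Local Notation D := (`[- pi, pi]%classic : set (measurableTypeR R)).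
Implicit Types (f g h F G H phi u v : R -> R).

(** The representative of x modulo 2 pi in [-pi, pi). *)
Definition wrap (x : R) : R :=
  x - pi *+ 2 * (Num.floor ((x + pi) / (pi *+ 2)))%:~R.

Lemma wrap_periodic (f : R -> R) : periodic (fun x => f (wrap x)) (pi *+ 2).
Proof.
move=> x; congr f; rewrite /wrap.
have pi20 : pi *+ 2 != 0 :> R by rewrite mulrn_eq0/= gt_eqF// pi_gt0.
have -> : (x + pi *+ 2 + pi) / (pi *+ 2) = (x + pi) / (pi *+ 2) + 1.
  by rewrite addrAC mulrDl divff.
rewrite floorDrz ?rpred1// floor1 rmorphD/= mulrDr mulr1 opprD.
by rewrite addrACA subrr addr0.
Qed.

Lemma wrap_id x : - pi <= x < pi -> wrap x = x.
Proof.
move=> /andP[x1 x2]; rewrite /wrap (@floor_def _ _ 0) ?mulr0 ?subr0//.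
have pi0 := pi_gt0 R; rewrite add0r mulr2n; apply/andP; split.
  by rewrite divr_ge0//; lra.
by rewrite ltr_pdivrMr; lra.
Qed.

Lemma wrap_pi : wrap pi = - pi.
Proof.
have := @wrap_periodic id (- pi).
have -> : - pi + pi *+ 2 = pi :> R by rewrite mulr2n addKr.
by move=> ->; rewrite wrap_id// lexx/= ltNpi_pi.
Qed.

Lemma measurable_wrap : measurable_fun [set: measurableTypeR R] wrap.
Proof.
apply: measurable_funB => //; apply: measurable_funM => //.
apply: nondecreasing_measurable => // x y xy.
rewrite ler_int le_floor// ler_pM2r ?lerD2r// invr_gt0 pmulrn_lgt0//.
exact: pi_gt0.
Qed.

(** Reflection about 0 turns a smooth profile on [0, pi] into periodic functions
    whose weak derivatives are the extensions, of the other parity, of the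
    derivative of the profile. *)
Definition even_ext F x := F `|wrap x|.
Definition odd_ext F x := Num.sg (wrap x) * F `|wrap x|.

Lemma even_ext_pos F x : 0 < x < pi -> even_ext F x = F x.
Proof. by move=> /andP[x1 x2]; rewrite /even_ext wrap_id ?gtr0_norm//;
  apply/andP; split; lra. Qed.

Lemma even_ext_neg F x : - pi < x < 0 -> even_ext F x = F (- x).
Proof. by move=> /andP[x1 x2]; rewrite /even_ext wrap_id ?ltr0_norm//;
  apply/andP; split; lra. Qed.

Lemma odd_ext_pos F x : 0 < x < pi -> odd_ext F x = F x.
Proof.
by move=> /andP[x1 x2]; rewrite /odd_ext wrap_id ?gtr0_norm ?gtr0_sg ?mul1r//;
  apply/andP; split; lra.
Qed.

Lemma odd_ext_neg F x : - pi < x < 0 -> odd_ext F x = - F (- x).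
Proof.
by move=> /andP[x1 x2]; rewrite /odd_ext wrap_id ?ltr0_norm ?ltr0_sg ?mulN1r//;
  apply/andP; split; lra.
Qed.

Lemma measurable_even_ext F : continuous F ->
  measurable_fun [set: measurableTypeR R] (even_ext F).
Proof.
move=> cF; apply: (measurableT_comp (continuous_measurable_fun cF)).
by apply: measurableT_comp => //; exact: measurable_wrap.
Qed.

Lemma measurable_odd_ext F : continuous F ->
  measurable_fun [set: measurableTypeR R] (odd_ext F).
Proof.
move=> cF; apply: measurable_funM; last exact: measurable_even_ext.
apply: (measurableT_comp _ measurable_wrap).
apply: nondecreasing_measurable => // x y xy.
by case: (sgrP x) => x0; case: (sgrP y) => y0; lra.
Qed.

Lemma sqintegrable_ext F f : continuous F -> measurable_fun D f ->
  (forall x, `|f x| <= `|F `|wrap x| |) -> sqintegrable f.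
Proof.
move=> cF mf fF; split => //.
have cF2 : continuous (fun x : R => F `|x|).
  by move=> x; exact: (continuous_comp (@norm_continuous _ R x) (cF `|x|)).
have [_ Fi] := sqintegrable_continuous cF2.
apply: (@le_integrable _ _ _ _ _ (@mperiod R) _ _ _ _ Fi).
  by apply/measurable_EFinP; exact: measurable_funX.
move=> x; rewrite /= in_itv/= => /andP[x1 x2].
rewrite lee_fin !normrX ler_sqr ?nnegrE// (le_trans (fF x))//.
move: x2; rewrite le_eqVlt => /predU1P[->|x2]; last by rewrite wrap_id// x1.
by rewrite wrap_pi normrN.
Qed.

Lemma L2_torus_even_ext F : continuous F -> L2_torus (even_ext F).
Proof.
move=> cF; have m := measurable_even_ext cF; apply: sqintegrable_L2_torus => //.
  exact: (wrap_periodic (fun y => F `|y|)).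
by apply: (sqintegrable_ext cF) => //; exact: measurable_funTS.
Qed.

Lemma L2_torus_odd_ext F : continuous F -> L2_torus (odd_ext F).
Proof.
move=> cF; have m := measurable_odd_ext cF; apply: sqintegrable_L2_torus => //.
  exact: (wrap_periodic (fun y => Num.sg y * F `|y|)).
apply: (sqintegrable_ext cF); first exact: measurable_funTS.
by move=> x; rewrite /odd_ext normrM ler_piMl// normr_sg lern1 leq_b1.
Qed.

Lemma is_derive_comp_opp F f (x : R) : (forall y : R, is_derive y 1 F (f y)) ->
  is_derive x 1 (fun y => F (- y)) (- f (- x)).
Proof.
move=> dF; have := @is_derive1_comp R F -%R x _ _ (dF (- x))
  (is_deriveNid x (1 : R)).
by rewrite mulrN1.
Qed.

Lemma pint_even f g G : pintegrable f ->
  (forall x, 0 < x < pi -> f x = g x) -> (forall x, - pi < x < 0 ->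
    f x = g (- x)) ->
  continuous g -> (forall x : R, is_derive x 1 G (g x)) ->
  pint f = 2 * (G pi - G 0).
Proof.
move=> fi f1 f2 cg dG.
have dH (x : R) : is_derive x 1 (fun y => - G (- y)) (g (- x)).
  have := is_deriveN (is_derive_comp_opp x dG); by rewrite opprK.
have cgN : continuous (fun x : R => g (- x)).
  by move=> x; apply: (@continuous_comp _ _ _ -%R g);
    [exact: opp_continuous|exact: cg].
by rewrite (pint_split fi f1 f2 cg cgN dG dH) oppr0 !opprK; ring.
Qed.

End Periodization.

Section WeakDerivativesOfExtensions.
Context {R : realType}.
Local Notation mu := (@lebesgue_measure R).
Implicit Types (F G phi u v w : R -> R).

Lemma test_is_derive phi : test_function phi ->
  forall x : R, is_derive x 1 phi ((phi^`())%classic x).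
Proof.
move=> [_ dphi] x; rewrite derive1E; apply: derivableP.
exact: (dphi 0%N x).
Qed.

Lemma test_derive1 phi : test_function phi -> test_function (phi^`())%classic.
Proof.
move=> [pphi dphi]; split.
  move=> x; rewrite /derive1.
  by under eq_fun => h do rewrite addrA !pphi.
by move=> n x; rewrite -derive1Sn; exact: dphi.
Qed.

Lemma test_continuous phi : test_function phi -> continuous phi.
Proof. by move=> /test_is_derive/is_derive_cont. Qed.

Lemma test_at_pi phi : test_function phi -> phi pi = phi (- pi).
Proof. by move=> [pphi _]; rewrite -[RHS]pphi mulr2n addKr. Qed.

Lemma weak_derivative0 u : weak_derivative 0 u u.
Proof. by move=> phi _; rewrite expr0 mul1r. Qed.

Lemma weak_derivative_trans u v w :
  weak_derivative 1 u v -> weak_derivative 1 v w -> weak_derivative 2 u w.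
Proof.
move=> uv vw phi tphi.
have -> : (phi^`(2))%classic = ((phi^`())^`(1))%classic by rewrite derive1Sn.
rewrite (uv _ (test_derive1 tphi)) -derive1n1 (vw _ tphi).
by rewrite mulrA -expr2 expr1.
Qed.

Lemma weak_derivative1I u v : sqintegrable u -> sqintegrable v ->
  (forall phi, test_function phi ->
     pint (fun x => u x * (phi^`())%classic x + v x * phi x) = 0) ->
  weak_derivative 1 u v.
Proof.
move=> ui vi h phi tphi; have := h _ tphi; rewrite pintD; last 2 first.
- apply: sqintegrable_mul => //; apply: sqintegrable_continuous.
  exact/test_continuous/test_derive1.
- by apply: sqintegrable_mul => //;
  exact/sqintegrable_continuous/test_continuous.
by move=> /eqP; rewrite addr_eq0 => /eqP e; rewrite expr1 mulN1r; exact: e.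
Qed.

Lemma continuous_compN F : continuous F -> continuous (fun x : R => F (- x)).
Proof.
by move=> cF x; apply: (@continuous_comp _ _ _ -%R F);
  [exact: opp_continuous|exact: cF].
Qed.

Lemma continuous_mulfun F G : continuous F -> continuous G ->
  continuous (fun x : R => F x * G x).
Proof. by move=> cF cG x; apply: cvgM; [exact: cF|exact: cG]. Qed.

Lemma continuous_addfun F G : continuous F -> continuous G ->
  continuous (fun x : R => F x + G x).
Proof. by move=> cF cG x; apply: cvgD; [exact: cF|exact: cG]. Qed.

Lemma continuous_oppfun F : continuous F -> continuous (fun x : R => - F x).
Proof. by move=> cF x; apply: cvgN; exact: cF. Qed.

(** The boundary terms at 0 cancel since the extension is continuous there,
    those at the ends of the period by periodicity of the test function. *)
Lemma weak_derivative_even_ext F (F1 : R -> R) : continuous F1 ->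
  (forall x : R, is_derive x 1 F (F1 x)) ->
  weak_derivative 1 (even_ext F) (odd_ext F1).
Proof.
move=> cF1 dF; have cF := is_derive_cont dF.
have ei := L2_torus_sqintegrable (L2_torus_even_ext cF).
have oi := L2_torus_sqintegrable (L2_torus_odd_ext cF1).
apply: weak_derivative1I => // phi tphi.
have dphi := test_is_derive tphi; have cphi := test_continuous tphi.
have cphi1 := test_continuous (test_derive1 tphi).
pose f x := even_ext F x * (phi^`())%classic x + odd_ext F1 x * phi x.
have fi : pintegrable f.
  by apply: pintegrableD; apply: sqintegrable_mul => //;
    exact: sqintegrable_continuous.
have dG (x : R) : is_derive x 1 (fun x => F x * phi x)
    (F1 x * phi x + F x * (phi^`())%classic x) by exact: is_derive_mul.
have dH (x : R) : is_derive x 1 (fun x => F (- x) * phi x)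
    (- F1 (- x) * phi x + F (- x) * (phi^`())%classic x).
  by apply: is_derive_mul => //; exact: is_derive_comp_opp.
rewrite (pint_split (f := f) fi _ _ _ _ dG dH).
- rewrite oppr0 opprK (test_at_pi tphi); ring.
- by move=> x hx; rewrite /f even_ext_pos// odd_ext_pos// addrC.
- by move=> x hx; rewrite /f even_ext_neg// odd_ext_neg// addrC.
- by apply: continuous_addfun; exact: continuous_mulfun.
- apply: continuous_addfun; apply: continuous_mulfun => //.
    by apply: continuous_oppfun; exact: continuous_compN.
  exact: continuous_compN.
Qed.

(** An odd extension jumps at 0 and at pi unless F vanishes there. *)
Lemma weak_derivative_odd_ext F (F1 : R -> R) : continuous F1 ->
  (forall x : R, is_derive x 1 F (F1 x)) -> F 0 = 0 -> F pi = 0 ->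
  weak_derivative 1 (odd_ext F) (even_ext F1).
Proof.
move=> cF1 dF F0 Fpi; have cF := is_derive_cont dF.
have oi := L2_torus_sqintegrable (L2_torus_odd_ext cF).
have ei := L2_torus_sqintegrable (L2_torus_even_ext cF1).
apply: weak_derivative1I => // phi tphi.
have dphi := test_is_derive tphi; have cphi := test_continuous tphi.
have cphi1 := test_continuous (test_derive1 tphi).
pose f x := odd_ext F x * (phi^`())%classic x + even_ext F1 x * phi x.
have fi : pintegrable f.
  by apply: pintegrableD; apply: sqintegrable_mul => //;
    exact: sqintegrable_continuous.
have dG (x : R) : is_derive x 1 (fun x => F x * phi x)
    (F1 x * phi x + F x * (phi^`())%classic x) by exact: is_derive_mul.
have dH (x : R) : is_derive x 1 (fun x => - F (- x) * phi x)
    (- - F1 (- x) * phi x + - F (- x) * (phi^`())%classic x).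
  apply: is_derive_mul => //; apply: is_deriveN; exact: is_derive_comp_opp.
rewrite (pint_split (f := f) fi _ _ _ _ dG dH).
- rewrite oppr0 opprK F0 Fpi; ring.
- by move=> x hx; rewrite /f even_ext_pos// odd_ext_pos// addrC.
- by move=> x hx; rewrite /f even_ext_neg// odd_ext_neg// opprK addrC.
- by apply: continuous_addfun; exact: continuous_mulfun.
- apply: continuous_addfun; apply: continuous_mulfun => //.
    by do 2 apply: continuous_oppfun; exact: continuous_compN.
  by apply: continuous_oppfun; exact: continuous_compN.
Qed.

(** If the essential supremum were below [F 0], it would be exceeded on an
    interval to the right of 0. *)
Lemma Linfnorm_even_ext F : continuous F ->
  ((F 0)%:E <= Linfnorm (even_ext F))%E.
Proof.
move=> cF; rewrite leNgt; apply/negP => hlt.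
have pi0 := pi_gt0 R.
have [e [e0 [epi he]]] : exists e : R, 0 < e /\ (e <= pi /\
    forall x, 0 < x < e -> (Linfnorm (even_ext F) < (F x)%:E)%E).
  have Lfin : Linfnorm (even_ext F) \is a fin_num.
    by rewrite ge0_fin_numE ?Linfnorm_ge0// (lt_trans hlt)// ltry.
  rewrite -(fineK Lfin) lte_fin in hlt *.
  have : \forall x \near (0 : R), fine (Linfnorm (even_ext F)) < F x by exact:
    (cvgr_gt _ (cF 0)).
  move=> /nbhs_ballP[e /= e0 he]; exists (Num.min e pi); split.
    by rewrite lt_min e0.
  split; first by rewrite ge_min lexx orbT.
  move=> x /andP[x0 xe]; rewrite lte_fin; apply: he.
  rewrite /ball/= sub0r normrN gtr0_norm//.
  by move: xe; rewrite lt_min => /andP[].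
have := ess_sup_ge (@torus_measure R) (abse \o (EFin \o even_ext F)).
have LE : Linfnorm (even_ext F) =
  ess_sup (@torus_measure R) (abse \o (EFin \o even_ext F)).
  by rewrite /Linfnorm unlock torus_measure_gt0.
rewrite -LE => -[N [mN N0 sub]].
have mI : measurable (`]0, e[%classic : set (measurableTypeR R)) by exact:
  measurable_itv.
have : (mu `]0%R, e[ <= @torus_measure R N)%E.
  rewrite torus_measureE; apply: le_measure; rewrite ?inE//.
    by apply: measurableI => //; exact: mperiod.
  move=> x /=; rewrite in_itv/= => xe; have /andP[x0 x1] := xe; split;
    last first.
    by rewrite /= in_itv/=; apply/andP; split; lra.
  apply: sub => /=; apply/negP; rewrite -ltNge.
  rewrite even_ext_pos; last by rewrite x0/=; lra.
  by apply: (lt_le_trans (he _ xe)); rewrite lee_fin ler_norm.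
rewrite [X in (_ <= X)%E]N0 lebesgue_measure_itv/= lte_fin e0 -EFinB subr0
  lee_fin.
by rewrite leNgt e0.
Qed.

End WeakDerivativesOfExtensions.

(** * Sharpness: the limit argument *)

Section SharpnessLimits.
Context {R : realType}.

Lemma le0_of_le_inv (x y : R) : (forall j : nat, x <= y / (2 * j.+1%:R)) ->
  x <= 0.
Proof.
move=> h; rewrite leNgt; apply/negP => x0.
have y0 : 0 < y.
  by have := h 0%N; move=> h0; have := lt_le_trans x0 h0;
    rewrite pmulr_lgt0 ?invr_gt0 ?mulr_gt0.
pose j := Num.truncn (y / x).
have := h j; rewrite ler_pdivlMr ?mulr_gt0// leNgt => /negP; apply.
have yx : y / x < j.+1%:R by exact: truncnS_gt.
have j0 : 0 < j.+1%:R :> R by rewrite ltr0n.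
rewrite ltr_pdivrMr// in yx; nra.
Qed.

(** Here [(1 - q) / (n pi)] is the mean that is subtracted from the trial
    function, a its squared norm and P the product term.  As n tends to
    infinity the inequality tends to [1 <= C K]; when [C = 1/K] the terms of
    order 1 cancel and those of order 1/n give [c kappa <= 1/pi].  The
    frequencies n are even so that [cos (n pi) = 1], which gives both trial
    families below the same mean. *)
Lemma sharpness_criterion (kappa K C c : R) : 0 < kappa -> 0 < K ->
  (forall j : nat, let n : R := 2 * j.+1%:R in let q := expR (- n * pi) in
   exists a P : R, [/\ 0 <= P, P <= K * (1 - (1 - q) ^+ 2 / (n * pi)),
     a = (kappa * (1 - q ^+ 2) - 2 * (1 - q) ^+ 2 / (n * pi)) / n &
     (1 - (1 - q) / (n * pi)) ^+ 2 <= C * P - c * a]) ->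
  K^-1 <= C /\ (C = K^-1 -> c <= (pi * kappa)^-1).
Proof.
move=> k0 K0 H; have pi3 := @pi_ge3 R; have pi0 := pi_gt0 R.
(* With d = 1/n, every quantity depending on n is within O(d) of its limit. *)
have est (j : nat) : let n : R := 2 * j.+1%:R in let q := expR (- n * pi) in
    [/\ 0 < n, 0 < n^-1 <= 2^-1, 0 <= q <= n^-1,
      0 < (n * pi)^-1 & (n * pi)^-1 <= n^-1].
  move=> n q; have j1 : 1 <= j.+1%:R :> R by rewrite ler1n.
  have n2 : 2 <= n by rewrite /n; lra.
  have n0 : 0 < n by lra.
  split => //.
  - by rewrite invr_gt0 n0/= lef_pV2 ?posrE.
  - rewrite expR_ge0/= /q mulNr expRN lef_pV2 ?posrE ?expR_gt0//.
    apply: le_trans (expR_ge1Dx _); nra.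
  - by rewrite invr_gt0 mulr_gt0.
  - rewrite lef_pV2 ?posrE ?mulr_gt0//; nra.
split.
  have X0 : 1 <= Num.max C 0 * K.
    rewrite -subr_le0; apply: (@le0_of_le_inv _ (2 + `|c| * (kappa + 2))) => j.
    have [n0 /andP[d0 d2] /andP[q0 qd] np0 npd] := est j;
      have [a [P [P0 PK aE ineq]]] := H j.
    move: n0 d0 d2 q0 qd np0 npd PK aE ineq.
    set n := 2 * j.+1%:R; set q := expR _; set r := (n * pi)^-1; set d := n^-1.
    move=> n0 d0 d2 q0 qd np0 npd PK aE ineq.
    have CP : C * P <= Num.max C 0 * K.
      apply: (@le_trans _ _ (Num.max C 0 * P));
        first by rewrite ler_wpM2r// le_max lexx.
      rewrite ler_wpM2l ?le_max ?lexx ?orbT// (le_trans PK)// ler_piMr ?(ltW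
        K0)//.
      by rewrite gerBl mulr_ge0 ?sqr_ge0// ltW.
    have q1 : q <= 1 by lra.
    have w1 : 0 <= 1 - q <= 1 by apply/andP; split; lra.
    have w2 : 0 <= (1 - q) ^+ 2 <= 1 by have /andP[? ?] := w1;
      rewrite exprn_ge0//= exprn_ile1.
    have q2 : 0 <= q ^+ 2 <= 1 by rewrite exprn_ge0//= exprn_ile1.
    have aa : `|a| <= (kappa + 2) * d.
      rewrite aE normrM [`|d|]gtr0_norm// ler_pM2r//.
      have /andP[? ?] := w2; have /andP[? ?] := q2.
      have kq : 0 <= kappa * (1 - q ^+ 2) <= kappa.
        by apply/andP; split; [rewrite mulr_ge0//; lra|rewrite ler_piMr; lra].
      have rw : 0 <= (1 - q) ^+ 2 * r <= 1.
        apply/andP; split; first by rewrite mulr_ge0// ltW.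
        by apply: mulr_ile1 => //; [exact: ltW|lra].
      have /andP[? ?] := kq; have /andP[? ?] := rw.
      by rewrite -/r -mulrA ler_norml; apply/andP; split; lra.
    have ca : - (c * a) <= `|c| * ((kappa + 2) * d).
      by rewrite (le_trans (ler_norm _))// normrN normrM ler_wpM2l.
    have m1 : 1 - 2 * d <= (1 - (1 - q) * r) ^+ 2.
      have /andP[? ?] := w1; have : (1 - q) * r <= d by apply: le_trans npd;
        rewrite ler_piMl// ltW.
      have := sqr_ge0 ((1 - q) * r); nra.
    rewrite -/d; have -> : (2 + `|c| * (kappa + 2)) * d =
      2 * d + `|c| * ((kappa + 2) * d) by ring.
    rewrite -/r in ineq; lra.
  have [C0|C0] := leP C 0.
    by move: X0; rewrite max_r// mul0r ler10.
  by rewrite -[K^-1]mul1r ler_pdivrMr//; move: X0; rewrite max_l// ltW.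
move=> CK; have [c0|c0] := leP c 0.
  by apply: (le_trans c0); rewrite invr_ge0 mulr_ge0 ?ltW.
rewrite invfM ler_pdivlMr// -subr_le0.
apply: (@le0_of_le_inv _ (c * (kappa + 2))) => j.
have [n0 /andP[d0 d2] /andP[q0 qd] np0 npd] := est j;
  have [a [P [P0 PK aE ineq]]] := H j.
move: n0 d0 d2 q0 qd np0 npd PK aE ineq.
set n := 2 * j.+1%:R; set q := expR _; set r := (n * pi)^-1; set d := n^-1.
move=> n0 d0 d2 q0 qd np0 npd PK aE ineq.
have CP : C * P <= 1 - (1 - q) ^+ 2 * r.
  by rewrite CK mulrC ler_pdivrMr// mulrC.
have rE : r = d / pi by rewrite /r invfM.
have w0 : 0 <= 1 - q by lra.
have ca : c * (kappa * (1 - q ^+ 2) - 2 * (1 - q) ^+ 2 * r) * d <= r.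
  have : c * a <= r.
    have : (1 - q) ^+ 2 * r = (1 - q) * ((1 - q) * r) by ring.
    have := sqr_ge0 ((1 - q) * r); rewrite -/r in ineq.
    have : 0 <= (2 * (1 - q) - (1 - q) ^+ 2) * r <= r.
      have -> : 2 * (1 - q) - (1 - q) ^+ 2 = 1 - q ^+ 2 by ring.
      rewrite mulr_ge0 ?subr_ge0 ?exprn_ile1 ?(ltW np0)//=; last lra.
      by rewrite ler_piMl ?(ltW np0)// gerBl exprn_ge0.
    move=> /andP[_ h1] h2 _; nra.
  by rewrite aE mulrA.
have {ca} : c * (kappa * (1 - q ^+ 2) - 2 * (1 - q) ^+ 2 * r) <= pi^-1.
  by rewrite -(ler_pM2r d0) [leRHS]mulrC -rE.
have q2d : q ^+ 2 <= d by rewrite expr2 (le_trans _ qd)// ler_piMl//; lra.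
have w2r : (1 - q) ^+ 2 * r <= d.
  apply: le_trans npd; rewrite ler_piMl ?(ltW np0)// exprn_ile1//; lra.
have : c * kappa - c * (kappa + 2) * d <=
  c * (kappa * (1 - q ^+ 2) - 2 * (1 - q) ^+ 2 * r).
  rewrite -mulrA -mulrBr ler_wpM2l ?(ltW c0)//.
  have : kappa * q ^+ 2 <= kappa * d by rewrite ler_wpM2l// ltW.
  by lra.
rewrite -/d; lra.
Qed.

End SharpnessLimits.

(** * Sharpness: the extremal families *)

Section ExtremalFamilies.
Context {R : realType}.
Local Notation mu := (@lebesgue_measure R).
Implicit Types (F G : R -> R).

Lemma pint_even_ext F G : continuous F ->
  (forall x : R, is_derive x 1 G (F x)) ->
  pint (even_ext F) = 2 * (G pi - G 0).
Proof.
move=> cF dG.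
have fi := sqintegrable_pintegrable (L2_torus_sqintegrable (L2_torus_even_ext
  cF)).
by apply: (pint_even fi _ _ cF dG) => x hx;
  [exact: even_ext_pos|exact: even_ext_neg].
Qed.

Lemma pint_sq_even_ext F G : continuous F ->
  (forall x : R, is_derive x 1 G (F x ^+ 2)) ->
  pint (fun x => even_ext F x ^+ 2) = 2 * (G pi - G 0).
Proof.
move=> cF dG; have [_ fi] := L2_torus_sqintegrable (L2_torus_even_ext cF).
have cF2 : continuous (fun x => F x ^+ 2) by exact: continuous_mulfun.
by apply: (pint_even fi _ _ cF2 dG) => x hx;
  [rewrite even_ext_pos|rewrite even_ext_neg].
Qed.

Lemma pint_sq_odd_ext F G : continuous F ->
  (forall x : R, is_derive x 1 G (F x ^+ 2)) ->
  pint (fun x => odd_ext F x ^+ 2) = 2 * (G pi - G 0).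
Proof.
move=> cF dG; have [_ fi] := L2_torus_sqintegrable (L2_torus_odd_ext cF).
have cF2 : continuous (fun x => F x ^+ 2) by exact: continuous_mulfun.
by apply: (pint_even fi _ _ cF2 dG) => x hx;
  [rewrite odd_ext_pos|rewrite odd_ext_neg// sqrrN].
Qed.

(** A lower bound for the sup norm may replace it in an instance of the
    inequality. *)
Lemma sup_norm_ineq_ge (u : R -> R) (x0 C c a P : R) : 0 <= x0 ->
  (x0%:E <= Linfnorm u)%E ->
  (Linfnorm u ^+ 2 <= C%:E * P%:E - c%:E * a%:E)%E -> x0 ^+ 2 <= C * P - c * a.
Proof.
move=> x00 xu h; rewrite -lee_fin EFinB !EFinM; apply: le_trans h.
by rewrite expe2; apply: lee_pmul.
Qed.

Lemma frequency_facts (j : nat) (n := 2 * j.+1%:R : R) (q := expR (- n * pi)) :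
  [/\ 0 < n, cos (- n * pi) = 1 /\ sin (- n * pi) = 0, 0 < q < 1,
    0 <= 1 - (1 - q) / (n * pi) & (1 - q) ^+ 2 / (n * pi) <= 2^-1].
Proof.
have pi3 := @pi_ge3 R; have j1 : 1 <= j.+1%:R :> R by rewrite ler1n.
have n2 : 2 <= n by rewrite /n; lra.
have nE : n = (2 * j.+1)%:R by rewrite natrM.
have np : 2 <= n * pi by nra.
have q01 : 0 < q < 1 by rewrite expR_gt0 /q -[ltRHS]expR0 ltr_expR; lra.
have /andP[q0 q1] := q01.
split => //.
- lra.
- rewrite !mulNr cosN sinN nE cos_natpi sin_natpi oppr0.
  by rewrite exprM sqrrN !expr1n.
- rewrite subr_ge0 ler_pdivrMr; lra.
- rewrite ler_pdivrMr; last lra.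
  apply: (@le_trans _ _ 1); last lra.
  by apply: exprn_ile1; lra.
Qed.

(** Trial function [exp (- n |x|) - m], whose weak derivative is the odd
    extension of [- n exp (- n x)]. *)
Lemma sharp_H1 : sharp_constants (@interpolation_H1 R) 1 (1 / pi).
Proof.
suff H (C c : R) : interpolation_H1 C c -> 1^-1 <= C /\ (C = 1^-1 ->
  c <= (pi * 1)^-1).
  split=> [C c /H[]|c /H[_]]; first by rewrite invr1.
  by rewrite invr1 mulr1 div1r; apply.
move=> hC; apply: (@sharpness_criterion R 1 1) => // j n q.
have [n0 _ /andP[q0 q1] m1 t1] := frequency_facts j;
  rewrite -/n -/q in n0 q0 q1 m1 t1.
have pi0 := pi_gt0 R; have np0 : 0 < n * pi by rewrite mulr_gt0.
pose m := (1 - q) / (n * pi); rewrite -/m in m1 *.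
have tE : (1 - q) ^+ 2 / (n * pi) = m * (1 - q) by rewrite /m; ring.
have mpi : m * pi = (1 - q) / n.
  by rewrite /m invfM mulrA mulfVK// gt_eqF.
have m2pi : m ^+ 2 * pi = m * (1 - q) / n by rewrite expr2 -mulrA mpi mulrA.
pose e (x : R) := expR (- n * x).
have de (x : R) : is_derive x 1 e (- n * e x) by exact: is_derive_expZ.
have ce : continuous e by exact: is_derive_cont de.
have e0 : e 0 = 1 by rewrite /e mulr0 expR0.
have epi : e pi = q by [].
pose F x := e x + - m; pose F1 x := - n * e x.
have dF (x : R) : is_derive x 1 F (F1 x).
  by have := is_derive_add (de x) (is_derive_cst (- m) x (1 : R));
    rewrite addr0.
have cF : continuous F := is_derive_cont dF.
have cF1 : continuous F1 by move=> x; apply: cvgMr; exact: ce.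
have dG (x : R) : is_derive x 1 (fun y => - n^-1 * e y + - m * y) (F x).
  have := is_derive_add (is_derive_scal (- n^-1) (de x))
    (is_derive_mull (- m) x).
  by congr is_derive; rewrite /F; field; rewrite gt_eqF.
have u0 : pint (even_ext F) = 0.
  rewrite (pint_even_ext cF dG) e0 epi mulNr mpi mulr0.
  by field; rewrite gt_eqF.
have dG2 (x : R) : is_derive x 1 (fun y =>
  (- (2 * n)^-1 * (e y * e y) + 2 * m / n * e y) +
    m ^+ 2 * y) (F x ^+ 2).
  have := is_derive_add (is_derive_add (is_derive_scal (- (2 * n)^-1)
    (is_derive_mul (de x) (de x)))
    (is_derive_scal (2 * m / n) (de x))) (is_derive_mull (m ^+ 2) x).
  by congr is_derive; rewrite /F; field; rewrite gt_eqF.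
have uu : pint (fun x => even_ext F x ^+ 2) =
  (1 * (1 - q ^+ 2) - 2 * (m * (1 - q))) / n.
  rewrite (pint_sq_even_ext cF dG2) e0 epi m2pi mulr0.
  by field; rewrite gt_eqF.
have dG3 (x : R) : is_derive x 1 (fun y => - (n / 2) * (e y * e y)) (F1 x ^+ 2).
  have := is_derive_scal (- (n / 2)) (is_derive_mul (de x) (de x)).
  by congr is_derive; rewrite /F1; field.
have vv : pint (fun x => odd_ext F1 x ^+ 2) = n * (1 - q ^+ 2).
  by rewrite (pint_sq_odd_ext cF1 dG3) e0 epi; field.
have Lu := L2_torus_even_ext cF; have Lv := L2_torus_odd_ext cF1.
have wd := weak_derivative_even_ext cF1 dF.
have su : sobolev_torus 1 (even_ext F).
  split => // -[_|[_|//]]; [exists (even_ext F)|exists (odd_ext F1)];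
    split => //.
  exact: weak_derivative0.
have := hC _ _ su u0 Lv wd.
rewrite (L2norm_pint Lu) (L2norm_pint Lv) -EFinM -EFin_expe =>
  /sup_norm_ineq_ge h.
have {h} := h _ m1.
have -> : (1 - m)%:E = (F 0)%:E by rewrite /F e0.
move=> /(_ (Linfnorm_even_ext cF)).
have uge0 : 0 <= pint (fun x => even_ext F x ^+ 2) by apply: pint_ge0 => x;
  exact: sqr_ge0.
have vge0 : 0 <= pint (fun x => odd_ext F1 x ^+ 2) by apply: pint_ge0 => x;
  exact: sqr_ge0.
rewrite sqr_sqrtr// => ineq; eexists; eexists; split; last exact: ineq.
- by rewrite mulr_ge0 ?sqrtr_ge0.
- rewrite tE in t1 *.
  rewrite mul1r -ler_sqr ?nnegrE ?mulr_ge0 ?sqrtr_ge0//; last lra.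
  rewrite exprMn !sqr_sqrtr// uu vv.
  have -> : (1 * (1 - q ^+ 2) - 2 * (m * (1 - q))) / n * (n * (1 - q ^+ 2)) =
    (1 - q ^+ 2) * (1 - q ^+ 2 - 2 * (m * (1 - q))) by field; rewrite gt_eqF.
  have q2 : 0 <= q ^+ 2 <= 1 by rewrite exprn_ge0 ?exprn_ile1 ?(ltW q0) ?(ltW
    q1).
  have /andP[q20 q21] := q2; move: (m * (1 - q)) t1 (q ^+ 2) q20 q21 =>
    t t1 Q Q0 Q1.
  have := sqr_ge0 t; nra.
- by rewrite uu -mulrA tE.
Qed.

(** The arithmetic-geometric mean inequality for Q and three copies of
    [Q - 4/3 t], whose mean is [Q - t]. *)
Lemma quartic_amgm (Q t : R) : 0 <= Q <= 1 -> 0 <= t -> 0 <= 1 - t ->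
  Q * (Q - 4 / 3 * t) ^+ 3 <= (1 - t) ^+ 4.
Proof.
move=> /andP[Q0 Q1] t0 t1; pose y := Q - 4 / 3 * t; rewrite -/y.
have [y0|y0] := leP y 0.
  apply: (@le_trans _ _ 0); last exact: exprn_ge0.
  by rewrite mulr_ge0_le0// exprS mulr_le0_ge0 ?sqr_ge0.
pose d := t / 3; have d0 : 0 <= d by rewrite divr_ge0.
have QE : Q = y + 4 * d by rewrite /y /d; field.
apply: (@le_trans _ _ ((y + d) ^+ 4)).
  rewrite QE -subr_ge0.
  have -> : (y + d) ^+ 4 - (y + 4 * d) * y ^+ 3 =
    d ^+ 2 * (6 * y ^+ 2 + 4 * (y * d) + d ^+ 2) by ring.
  have := mulr_ge0 (ltW y0) d0; have := sqr_ge0 y; have := sqr_ge0 d => *.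
  by apply: mulr_ge0 => //; lra.
apply: lerXn2r; rewrite ?nnegrE//; rewrite /y /d in y0 d0 *; lra.
Qed.

Lemma powR_product_pow4 (A B : R) : 0 <= A -> 0 <= B ->
  (A `^ (3 / 2) * B `^ (1 / 2)) ^+ 4 = (A ^+ 2) ^+ 3 * B ^+ 2.
Proof.
move=> A0 B0; rewrite exprMn -exprM -!powR_mulrn ?powR_ge0// -!powRrM.
by congr (_ `^ _ * _ `^ _); field.
Qed.

(** Trial function [exp (- n |x|) (cos (n x) + sin (n |x|)) - m].  Its
    derivative is proportional to [exp (- n x) sin (n x)] for x > 0, which
    vanishes at 0 and at pi, so the second weak derivative has no singular
    part. *)
Lemma sharp_H2 : sharp_constants (@interpolation_H2 R)
  (Num.sqrt 2 / (27 `^ (1 / 4))) (2 / (3 * pi)).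
Proof.
have [] := @leading_constant_H2_pow4 R; set C0 := Num.sqrt 2 / _;
  clearbody C0 => C0_gt0 C04.
suff H (C c : R) : interpolation_H2 C c ->
    C0^-1^-1 <= C /\ (C = C0^-1^-1 -> c <= (pi * (3 / 2))^-1).
  have E : (pi * (3 / 2))^-1 = 2 / (3 * pi) :> R.
    rewrite invfM invf_div invfM; move: (pi^-1) => p; ring.
  split=> [C c /H[]|c /H[_]]; first by rewrite invrK.
  by rewrite invrK E; apply.
move=> hC; apply: (@sharpness_criterion R (3 / 2) C0^-1);
  [lra|by rewrite invr_gt0|move=> j n q].
have [n0 [cpi spi] /andP[q0 q1] m1 t1] := frequency_facts j.
rewrite -/n -/q in n0 cpi spi q0 q1 m1 t1.
have pi0 := pi_gt0 R; have np0 : 0 < n * pi by rewrite mulr_gt0.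
pose m := (1 - q) / (n * pi); rewrite -/m in m1 *.
have tE : (1 - q) ^+ 2 / (n * pi) = m * (1 - q) by rewrite /m; ring.
have mpi : m * pi = (1 - q) / n.
  by rewrite /m invfM mulrA mulfVK// gt_eqF.
have m2pi : m ^+ 2 * pi = m * (1 - q) / n by rewrite expr2 -mulrA mpi mulrA.
(* The frequency - n makes exponential and oscillation share one argument, as
   in [is_derive_osc]; the sine amplitude is then -1. *)
pose e (x : R) := expR (- n * x); pose co (x : R) := cos (- n * x);
  pose si (x : R) := sin (- n * x).
have de (x : R) : is_derive x 1 e (- n * e x) by exact: is_derive_expZ.
have dc (x : R) : is_derive x 1 co (- (- n * si x)) by exact: is_derive_cosZ.
have ds (x : R) : is_derive x 1 si (- n * co x) by exact: is_derive_sinZ.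
have e0 : e 0 = 1 by rewrite /e mulr0 expR0.
have c0 : co 0 = 1 by rewrite /co mulr0 cos0.
have s0 : si 0 = 0 by rewrite /si mulr0 sin0.
have epi : e pi = q by [].
have cpi' : co pi = 1 by [].
have spi' : si pi = 0 by [].
pose F x := e x * (1 * co x + -1 * si x) + - m.
pose F1 x := - n * (e x * ((1 + -1) * co x + (-1 - 1) * si x)).
pose F2 x := - n * (- n * (e x * ((1 + -1 + (-1 - 1)) * co x + (-1 - 1 - (1 +
  -1)) * si x))).
have dF (x : R) : is_derive x 1 F (F1 x).
  by have := is_derive_add (is_derive_osc (- n) 1 (-1) x)
    (is_derive_cst (- m) x (1 : R)); rewrite addr0.
have dF1 (x : R) : is_derive x 1 F1 (F2 x).
  by have := is_derive_scal (- n) (is_derive_osc (- n) (1 + -1) (-1 - 1) x).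
have cF : continuous F := is_derive_cont dF.
have cF1 : continuous F1 := is_derive_cont dF1.
have cF2 : continuous F2.
  pose F3 x := - n * (- n * (- n * (e x * (((1 + -1 + (-1 - 1)) + (-1 - 1 - (1 +
    -1))) * co x +
     ((-1 - 1 - (1 + -1)) - (1 + -1 + (-1 - 1))) * si x)))).
  have dF2 (x : R) : is_derive x 1 F2 (F3 x).
    by have := is_derive_scal (- n) (is_derive_scal (- n)
      (is_derive_osc (- n) (1 + -1 + (-1 - 1)) (-1 - 1 - (1 + -1)) x)).
  exact: is_derive_cont dF2.
have F10 : F1 0 = 0 by rewrite /F1 s0; ring.
have F1pi : F1 pi = 0 by rewrite /F1 spi'; ring.
have dG (x : R) : is_derive x 1 (fun y =>
  - n^-1 * (e y * co y) + - m * y) (F x).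
  have := is_derive_add (is_derive_scal (- n^-1) (is_derive_mul (de x) (dc x)))
    (is_derive_mull (- m) x).
  by congr is_derive; rewrite /F; field; rewrite gt_eqF.
have u0 : pint (even_ext F) = 0.
  rewrite (pint_even_ext cF dG) e0 epi c0 cpi' mulNr mpi mulr0.
  by field; rewrite gt_eqF.
have dG2 (x : R) : is_derive x 1 (fun y => (- (4 * n)^-1 *
    ((e y * e y) * ((3 * (co y * co y) + si y * si y) + - 2 * (co y * si y))) +
    2 * m / n * (e y * co y)) + m ^+ 2 * y) (F x ^+ 2).
  have := is_derive_add (is_derive_add (is_derive_scal (- (4 * n)^-1)
    (is_derive_mul (is_derive_mul (de x) (de x))
      (is_derive_add (is_derive_add (is_derive_scal 3 (is_derive_mul (dc x)
        (dc x)))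
        (is_derive_mul (ds x) (ds x))) (is_derive_scal (- 2)
          (is_derive_mul (dc x) (ds x))))))
    (is_derive_scal (2 * m / n) (is_derive_mul (de x) (dc x))))
      (is_derive_mull (m ^+ 2) x).
  by congr is_derive; rewrite /F; field; rewrite gt_eqF.
have uu : pint (fun x => even_ext F x ^+ 2) =
  (3 / 2 * (1 - q ^+ 2) - 2 * (m * (1 - q))) / n.
  rewrite (pint_sq_even_ext cF dG2) e0 epi c0 cpi' s0 spi' m2pi mulr0.
  by field; rewrite gt_eqF.
have dG3 (x : R) : is_derive x 1 (fun y => - n ^+ 3 *
    ((e y * e y) * ((co y * co y + 3 * (si y * si y)) +
      2 * (co y * si y)))) (F2 x ^+ 2).
  have := is_derive_scal (- n ^+ 3) (is_derive_mul (is_derive_mul (de x) (de x))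
      (is_derive_add (is_derive_add (is_derive_mul (dc x) (dc x))
        (is_derive_scal 3 (is_derive_mul (ds x) (ds x))))
          (is_derive_scal 2 (is_derive_mul (dc x) (ds x))))).
  by congr is_derive; rewrite /F2; ring.
have vv : pint (fun x => even_ext F2 x ^+ 2) = 2 * n ^+ 3 * (1 - q ^+ 2).
  by rewrite (pint_sq_even_ext cF2 dG3) e0 epi c0 cpi' s0 spi'; ring.
have Lu := L2_torus_even_ext cF; have Lv := L2_torus_odd_ext cF1.
have Lw := L2_torus_even_ext cF2.
have wd1 := weak_derivative_even_ext cF1 dF.
have wd2 := weak_derivative_trans wd1 (weak_derivative_odd_ext cF2 dF1 F10
  F1pi).
have su : sobolev_torus 2 (even_ext F).
  split => // -[_|[_|[_|//]]]; [exists (even_ext F)|exists (odd_ext F1)|exists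
    (even_ext F2)];
    split => //; exact: weak_derivative0.
have := hC _ _ su u0 Lw wd2.
rewrite (L2norm_pint Lu) (L2norm_pint Lw) !poweR_EFin -EFinM -EFin_expe =>
  /sup_norm_ineq_ge h.
have {h} := h _ m1.
have -> : (1 - m)%:E = (F 0)%:E by rewrite /F e0 c0 s0; congr EFin; ring.
move=> /(_ (Linfnorm_even_ext cF)).
have uge0 : 0 <= pint (fun x => even_ext F x ^+ 2) by apply: pint_ge0 => x;
  exact: sqr_ge0.
have vge0 : 0 <= pint (fun x => even_ext F2 x ^+ 2) by apply: pint_ge0 => x;
  exact: sqr_ge0.
rewrite sqr_sqrtr// => ineq; eexists; eexists; split; last exact: ineq.
- by rewrite mulr_ge0 ?powR_ge0.
- rewrite tE in t1 *.
  set A := Num.sqrt _; set B := Num.sqrt _.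
  have A0 : 0 <= A := sqrtr_ge0 _; have B0 : 0 <= B := sqrtr_ge0 _.
  have P0 : 0 <= A `^ (3 / 2) * B `^ (1 / 2) by rewrite mulr_ge0 ?powR_ge0.
  have t0 : 0 <= 1 - m * (1 - q) by rewrite subr_ge0 (le_trans t1)// invf_le1//
    ler1n.
  have R0 : 0 <= C0^-1 * (1 - m * (1 - q)) by rewrite mulr_ge0 ?invr_ge0 ?(ltW
    C0_gt0).
  rewrite -(@ler_pXn2r _ 4) ?nnegrE// powR_product_pow4// [in leRHS]exprMn /A /B
    !sqr_sqrtr// uu vv exprVn C04.
  have m0 : 0 <= m * (1 - q) by rewrite -tE divr_ge0 ?sqr_ge0// ltW.
  have -> : ((3 / 2 * (1 - q ^+ 2) - 2 * (m * (1 -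
    q))) / n) ^+ 3 * (2 * n ^+ 3 * (1 - q ^+ 2)) =
     27 / 4 * ((1 - q ^+ 2) * (1 - q ^+ 2 - 4 / 3 * (m * (1 - q))) ^+ 3).
    by clear - n0; field; rewrite gt_eqF.
  rewrite invf_div ler_wpM2l//; apply: quartic_amgm => //.
  by rewrite subr_ge0 gerBl sqr_ge0 exprn_ile1 ?(ltW q0) ?(ltW q1).
- by rewrite uu -tE mulrA.
Qed.

End ExtremalFamilies.

Theorem theorem3p7 (R : realType) :
  (interpolation_H1 (1 : R) (1 / pi) /\
   interpolation_H2 (Num.sqrt 2 / (27 `^ (1 / 4)) : R) (2 / (3 * pi))) /\
  (sharp_constants (@interpolation_H1 R) 1 (1 / pi) /\
   sharp_constants (@interpolation_H2 R)
     (Num.sqrt 2 / (27 `^ (1 / 4))) (2 / (3 * pi))).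
Proof.
split; split.
- exact: interpolation_H1_holds.
- exact: interpolation_H2_holds.
- exact: sharp_H1.
- exact: sharp_H2.
Qed.
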